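(* Let a set $X$ of cycles be called a cycle obstruction set for unbalanced $2$-partitionability if there exists a nonnegative integer $D$ such that every planar graph containing none of the cycles in $X$ as a subgraph is $(0,D)$-colorable. Then the inclusion-wise minimal cycle obstruction sets for unbalanced $2$-partitionability are exactly $\{C_{2i+1} : i \ge 1\}$ (the set of all odd cycles) and $\{C_3, C_4, C_6\}$.
   Context: All graphs are finite and simple. $C_k$ denotes the cycle of length $k$; cycles are considered up to isomorphism. For nonnegative integers $k,d_1,\dots,d_k$, a graph is $(d_1,\dots,d_k)$-colorable if its vertex set can be partitioned into $k$ parts $V_1,\dots,V_k$ such that $V_i$ induces a subgraph of maximum degree at most $d_i$ for every $i$. A class of graphs is unbalanced $k$-partitionable if there is a nonnegative integer $D$ such that every graph in the class is $(0,\dots,0,D)$-colorable (tuple of length $k$). A set $X$ of cycles is a cycle obstruction set of a class $\mathcal C$ of planar graphs if every planar graph containing no cycle of $X$ as a subgraph belongs to $\mathcal C$. *)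

(* Defs.v *)
From HB Require Import structures.
From mathcomp Require Import all_boot all_order all_algebra.
From mathcomp Require Import boolp classical_sets reals.

Set Implicit Arguments.
Unset Strict Implicit.
Unset Printing Implicit Defensive.

Import Order.TTheory GRing.Theory Num.Theory.
Local Open Scope classical_set_scope.

Record sgraph := SGraph {
  vertex :> finType;
  adj : rel vertex;
  adj_sym : symmetric adj;
  adj_irrefl : irreflexive adj }.

Arguments adj {s}.

(* Not necessarily induced. *)
Definition has_subgraph (G H : sgraph) : Prop :=
  exists2 f : H -> G, injective f & forall x y, adj x y -> adj (f x) (f y).

Section CycleGraph.
Variable k : nat.

Definition cycle_adj : rel 'I_k :=
  [rel i j | (i != j) && ((ordS i == j) || (ordS j == i))].

Lemma cycle_adj_sym : symmetric cycle_adj.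
Proof. by move=> i j; rewrite /cycle_adj /= eq_sym orbC. Qed.

Lemma cycle_adj_irrefl : irreflexive cycle_adj.
Proof. by move=> i; rewrite /cycle_adj /= eqxx. Qed.

(* This is the cycle C_k only for 3 <= k. *)
Definition cycle_graph : sgraph := SGraph cycle_adj_sym cycle_adj_irrefl.

End CycleGraph.

(* A coloring c encodes the partition into the parts V_i := c^-1(i), which may
   be empty. *)
Definition colorable (k : nat) (d : k.-tuple nat) (G : sgraph) : Prop :=
  exists c : G -> 'I_k, forall (i : 'I_k) (v : G), c v = i ->
    #|[pred w : G | adj v w && (c w == i)]| <= tnth d i.

(* Planarity follows Diestel, Graph Theory, Section 4.2: edges of a plane graph
   are drawn as simple polygonal arcs in the real plane. *)
Section Planar.
Variable R : realType.
Local Open Scope ring_scope.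

Definition plane : Type := R * R.

Definition segment (p q : plane) : set plane :=
  [set z | exists2 t : R, 0 <= t <= 1 &
     z = ((1 - t) * p.1 + t * q.1, (1 - t) * p.2 + t * q.2)].

(* The arc has the n + 1 segments [p 0, p 1], ..., [p n, p (n + 1)]; the values
   of p beyond n + 1 are irrelevant. *)
Definition polygonal_arc (P : set plane) (a b : plane) : Prop :=
  exists (n : nat) (p : nat -> plane),
    [/\ p 0%N = a /\ p n.+1 = b,
        forall i, (i <= n)%N -> p i <> p i.+1,
        forall i, (i < n)%N ->
          segment (p i) (p i.+1) `&` segment (p i.+1) (p i.+2)
            = [set p i.+1],
        forall i j, (i.+1 < j <= n)%N ->
          segment (p i) (p i.+1) `&` segment (p j) (p j.+1) = set0 &
        P = \bigcup_(i in [set i | (i <= n)%N]) segment (p i) (p i.+1)].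

(* The edge joining x and y is represented by the pair [set x; y]. *)
Definition plane_drawing (G : sgraph)
    (pos : G -> plane) (arc : {set G} -> set plane) : Prop :=
  let interior x y := arc [set x; y]%SET `\` [set pos x; pos y] in
  [/\ injective pos,
      forall x y, adj x y -> polygonal_arc (arc [set x; y]%SET) (pos x) (pos y),
      forall x y z, adj x y -> ~ interior x y (pos z) &
      forall x y x' y', adj x y -> adj x' y' ->
        [set x; y]%SET <> [set x'; y']%SET ->
        interior x y `&` arc [set x'; y']%SET = set0].

Definition planar (G : sgraph) : Prop :=
  exists (pos : G -> plane) (arc : {set G} -> set plane), plane_drawing pos arc.

End Planar.

(* A set of cycles, taken up to isomorphism, is encoded by the set of the
   lengths of its members. *)
Definition cycle_set (X : set nat) : Prop := X `<=` [set k | 3 <= k].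

Definition cycle_obstruction_set (R : realType) (X : set nat) : Prop :=
  cycle_set X /\
  exists D : nat, forall G : sgraph, planar R G ->
    (forall k, X k -> ~ has_subgraph G (cycle_graph k)) ->
    colorable [tuple 0; D] G.

Definition minimal_cycle_obstruction_set (R : realType) (X : set nat) : Prop :=
  cycle_obstruction_set R X /\
  forall Y : set nat, Y `<=` X -> cycle_obstruction_set R Y -> Y = X.

(* Main.v *)
(* The families not containing an odd cycle C_l and one of C_3, C_4, C_6 are not
   obstruction sets: blow up vertices of C_l so that its only further cycles are
   C_4 (parallel paths of length 2) or C_6 (parallel paths of length 3). Many
   parallel paths of length 2 force equal colours on their ends, and many of
   length 3 forbid that both ends lie in the part of bounded degree. Going around
   C_l, this forces the colour of one vertex, and joining copies through bridges
   leaves no colouring. These graphs have two-page book embeddings.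

   Conversely, a minimal non-(0,40)-colourable planar graph without C_3, C_4, C_6
   has minimum degree 2, and all its vertices of degree at most 41 have a
   neighbour of degree at least 42. Faces have length 5 or at least 7, and the two
   faces at a vertex of degree 2 are not both pentagons, since these would form a
   C_6. Discharging then contradicts Euler's inequality E + 1 <= V + F for the
   faces traced by the rotation system of a drawing. That inequality is a count:
   an even edge set Z is the boundary of the faces on which the parity of the
   number of crossings with Z is odd, so there are at most 2^F even edge sets,
   whereas there are at least 2^(E - V + 1). *)

Require Import Defs.
From mathcomp Require Import all_boot all_order all_algebra.
From mathcomp Require Import boolp classical_sets reals.
From mathcomp Require Import zify ring lra.
(* Reimported because [classical_sets] shadows lemma names of [finset]. *)
From mathcomp Require Import fintype finset.

Set Implicit Arguments.
Unset Strict Implicit.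
Unset Printing Implicit Defensive.

Import Order.TTheory GRing.Theory Num.Theory.

(** * Euler's inequality for rotation systems *)

(** The Jordan curve theorem is bypassed: faces are orbits of darts, and the only topology used is
    that the parity of crossings with an even edge set stays constant along such an orbit. After a
    shear that gives distinct points of the drawing distinct abscissae, this parity is read off
    upward vertical rays by comparing affine functions. The constant 40 comes from the discharging.
    A vertex of degree d starts with 28 d - 84, which pays 26 along every edge exactly when d >= 42,
    so low vertices have degree at most 41. Putting a deleted vertex back into a colouring of the
    rest, and repairing its overfull neighbours, works for degrees up to D + 1; hence D = 40. Two
    kinds of blown-up cycles are used because parallel paths of length 2 avoid C_6 and those of
    length 3 avoid C_4. The triangle blown up in the second way consists of triangles sharing a
    vertex, so every obstruction set contains C_3. *)

Definition oriented (G : sgraph) : pred (G * G) :=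
  [pred e | adj e.1 e.2 && (enum_rank e.1 < enum_rank e.2)].
Arguments oriented : clear implicits.

Lemma big_oriented (T : Type) (idx : T) (op : Monoid.com_law idx)
    (G : sgraph) (F : G -> G -> T) :
  (forall x y, ~~ adj x y -> F x y = idx) ->
  \big[op/idx]_x \big[op/idx]_y F x y =
  \big[op/idx]_(e | oriented G e) op (F e.1 e.2) (F e.2 e.1).
Proof.
move=> F0; rewrite pair_big /= big_split /=.
rewrite (bigID (oriented G)) /=; congr (op _ _).
rewrite [RHS](reindex (fun e : G * G => (e.2, e.1))) /=; last first.
  by exists (fun e : G * G => (e.2, e.1)) => -[].
rewrite big_mkcond [RHS]big_mkcond /=; apply: eq_bigr => -[x y] _ /=.
rewrite /oriented /= [adj y x]adj_sym.
case: (boolP (adj x y)) => [axy|/F0->] //=.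
case: ltngtP => // /val_inj/enum_rank_inj e.
by move: axy; rewrite e adj_irrefl.
Qed.

Lemma addb_oriented (G : sgraph) (F : G -> G -> bool) :
  (forall x y, ~~ adj x y -> F x y = false) ->
  \big[addb/false]_(e | oriented G e) (F e.1 e.2 (+) F e.2 e.1) =
  \big[addb/false]_x \big[addb/false]_y F x y.
Proof. by move=> F0; rewrite big_oriented. Qed.

Lemma card_oriented (G : sgraph) :
  \sum_(x : G) #|[pred y | adj x y]| = (#|[set e | oriented G e]|).*2.
Proof.
under eq_bigr do rewrite -sum1_card big_mkcond /=.
rewrite (@big_oriented _ _ addn) => [|x y]; last by rewrite inE => /negPf->.
rewrite -muln2 -sum1_card big_distrl /=.
rewrite [RHS](eq_bigl (oriented G)) => [|e]; last by rewrite inE.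
apply: eq_bigr => -[x y] /andP[/= axy _].
by rewrite !inE [adj y x]adj_sym axy.
Qed.

Lemma handshake_addb (G : sgraph) (Z : rel G) :
  symmetric Z -> subrel Z adj ->
  \big[addb/false]_x \big[addb/false]_y Z x y = false.
Proof.
move=> Zsym Zadj; rewrite -addb_oriented => [|x y]; last first.
  by apply: contraNF; apply: Zadj.
by rewrite big1 // => e _; rewrite [Z e.2 _]Zsym addbb.
Qed.

Section Faces.
Variables (G : sgraph) (s : G -> seq G).
Hypothesis s_uniq : forall x, uniq (s x).
Hypothesis mem_s : forall x y, (y \in s x) = adj x y.

Definition dart := {d : G * G | adj d.1 d.2}.

Fact face_next_subproof (d : dart) :
  adj (val d).2 (prev (s (val d).2) (val d).1).
Proof. by rewrite -mem_s mem_prev mem_s adj_sym; apply: (valP d). Qed.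

(** When [s] lists neighbours counterclockwise, the orbit traces the face on the left of its
    darts. *)
Definition face_next (d : dart) : dart :=
  exist (fun d : G * G => adj d.1 d.2) (_, _) (face_next_subproof d).

Lemma face_next_inj : injective face_next.
Proof.
move=> [[x y] d] [[x' y'] d'] /(congr1 val) [/= eyy' exx'].
rewrite -{}eyy' in d' exx' *; apply: val_inj => /=; congr (_, _).
exact: can_inj (next_prev (s_uniq y)) _ _ exx'.
Qed.

(* Even edge sets have primitives that are constant along faces; this is what
   planarity provides. *)
Definition separating := forall Z : rel G,
  symmetric Z -> subrel Z adj ->
  (forall x, \big[addb/false]_y Z x y = false) ->
  exists W : rel G,
    (forall x y, adj x y -> W x y (+) W y x = Z x y) /\
    (forall x y, adj x y -> W y (prev (s y) x) = W x y).

Lemma card_dart : #|{: dart}| = (#|[set e | oriented G e]|).*2.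
Proof.
rewrite -card_oriented card_sig.
under eq_bigr do rewrite -sum1_card.
rewrite pair_big_dep /= sum1_card.
by apply: eq_card => -[x y]; rewrite !inE.
Qed.

Hypothesis sepG : separating.

Let edges := [set e | oriented G e].
Let relof (A : {set G * G}) : rel G := fun x y => ((x, y) \in A) || ((y, x) \in A).

(** Both counts are merged into one injection: an edge set [A] is recovered from its boundary and
    from the values on faces of a primitive of [A] plus a fixed edge set with the same boundary. So
    2^E is at most 2^(V - 1) times 2^F. *)
Lemma euler_ineq (x0 : G) :
  #|{: dart}| + 2 <= (#|G| + fcard face_next {: dart}).*2.
Proof.
have relof_sym A : symmetric (relof A) by move=> x y; rewrite /relof orbC.
have relof_adj (A : {set G * G}) : A \subset edges -> subrel (relof A) adj.
  move=> /subsetP sA x y /orP[] /sA; rewrite inE /oriented /= => /andP[] //.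
  by rewrite adj_sym.
have relof_inj (A B : {set G * G}) : A \subset edges -> B \subset edges ->
    (forall x y, relof A x y = relof B x y) -> A = B.
  move=> sA sB AB; apply/setP => -[x y].
  have half (C : {set G * G}) : C \subset edges ->
      ((x, y) \in C) = (enum_rank x < enum_rank y) && relof C x y.
    move=> /subsetP sC; apply/idP/andP => [h|[lt /orP[//|/sC]]].
      by split; [move/sC: h; rewrite inE => /andP[] | rewrite /relof h].
    by rewrite inE /oriented /= => /andP[_ /(ltn_trans lt)]; rewrite ltnn.
  by rewrite !half // AB.
(* Leaving out [x0] loses nothing, since by the handshake lemma the parity at [x0] follows from the
   others; this saves the factor 2 behind the [+ 2]. *)
pose bd (A : {set G * G}) :=
  [set x | (x != x0) && \big[addb/false]_y relof A x y].
pose rep (S : {set G}) :=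
  odflt set0 [pick A : {set G * G} | (A \subset edges) && (bd A == S)].
have repP (A : {set G * G}) : A \subset edges -> (rep (bd A) \subset edges) && (bd (rep (bd A)) == bd A).
  move=> sA; rewrite /rep; case: pickP => [B //|/(_ A)].
  by rewrite sA eqxx.
pose df A := fun x y => relof A x y (+) relof (rep (bd A)) x y.
have exW (A : {set G * G}) : exists W : rel G, A \subset edges ->
    (forall x y, adj x y -> W x y (+) W y x = df A x y) /\
    (forall x y, adj x y -> W y (prev (s y) x) = W x y).
  case: (boolP (A \subset edges)) => [sA|]; last by exists adj.
  have /andP[sB /eqP bdB] := repP _ sA.
  have dsym : symmetric (df A).
    by move=> x y; rewrite /df relof_sym [X in _ (+) X]relof_sym.
  have dadj : subrel (df A) adj.
    move=> x y; rewrite /df; case: (boolP (relof A x y)) => [/(relof_adj _ sA)//|_].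
    by rewrite addFb => /(relof_adj _ sB).
  have d0 x : x != x0 -> \big[addb/false]_y df A x y = false.
    move=> xx0; rewrite big_split /=.
    move/setP/(_ x): bdB; rewrite !inE xx0 /= => ->; exact: addbb.
  have [|W WP] := sepG dsym dadj; last by exists W.
  move=> x; case: (eqVneq x x0) => [->|/d0//].
  have := handshake_addb dsym dadj.
  by rewrite (bigD1 x0) //= [X in _ (+) X]big1 ?addbF.
pose W A := projT1 (cid (exW A)).
have WP (A : {set G * G}) : A \subset edges ->
    (forall x y, adj x y -> W A x y (+) W A y x = df A x y) /\
    (forall x y, adj x y -> W A y (prev (s y) x) = W A x y).
  by rewrite /W; case: cid.
pose WF A := [set d : dart | (d \in froots face_next) && W A (val d).1 (val d).2].
pose h A := (bd A, WF A).
have Wroot (A : {set G * G}) d : A \subset edges ->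
    W A (val d).1 (val d).2 = (froot face_next d \in WF A).
  move=> /WP [_ WA]; rewrite inE.
  have csym : connect_sym (frel face_next) by exact: fconnect_sym face_next_inj.
  have -> : froot face_next d \in froots face_next by exact: roots_root csym _.
  have itW n : W A (val (iter n face_next d)).1 (val (iter n face_next d)).2 =
      W A (val d).1 (val d).2.
    by elim: n => //= n <-; rewrite WA //; exact: (valP (iter n face_next d)).
  have /iter_findex e : fconnect face_next d (froot face_next d).
    exact: connect_root.
  by rewrite -[in RHS]e itW.
have h_inj : {in powerset edges &, injective h}.
  move=> A B; rewrite !inE => sA sB [eb eW].
  apply: relof_inj => // x y.
  case: (boolP (adj x y)) => [axy|naxy]; last first.
    have F (C : {set G * G}) : C \subset edges -> relof C x y = false.
      by move=> sC; apply: contraNF naxy; apply: relof_adj sC _ _.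
    by rewrite !F.
  have ayx : adj y x by rewrite adj_sym.
  have [WA _] := WP _ sA; have [WB _] := WP _ sB.
  have e1 : W A x y = W B x y.
    have := Wroot A (exist (fun d : G * G => adj d.1 d.2) (x, y) axy) sA.
    by rewrite eW -Wroot.
  have e2 : W A y x = W B y x.
    have := Wroot A (exist (fun d : G * G => adj d.1 d.2) (y, x) ayx) sA.
    by rewrite eW -Wroot.
  have := WA _ _ axy; rewrite e1 e2 WB // /df eb.
  by move/addIb.
have := card_in_imset h_inj.
rewrite card_powerset => card_h.
have : #|h @: powerset edges| <=
    #|setX (powerset [set~ x0]) (powerset [set d | d \in froots face_next])|.
  apply/subset_leq_card/subsetP => _ /imsetP[A _ ->].
  rewrite !inE; apply/andP; split; apply/subsetP => x; rewrite !inE => /andP[] //.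
rewrite card_h cardsX !card_powerset -expnD leq_exp2l // card_dart -/edges.
have -> : #|[set d | d \in froots face_next]| = fcard face_next {: dart}.
  by rewrite /n_comp_mem; apply: eq_card => d; rewrite !inE andbT.
have := cardsC1 x0; have : 0 < #|G| by apply/card_gt0P; exists x0.
move=> ? ->; lia.
Qed.

End Faces.

(** * Parity of crossings for segments in the plane *)

Section Segments.
Variable R : realFieldType.
Local Open Scope ring_scope.
Implicit Types a b c d v t u w : (R * R)%type.

Definition slope a b : R := (b.2 - a.2) / (b.1 - a.1).
Definition line a b (x : R) : R := a.2 + slope a b * (x - a.1).

Lemma slopeC a b : slope a b = slope b a.
Proof. by rewrite /slope -[b.2 - _]opprB -[b.1 - _]opprB invrN mulrNN. Qed.

Lemma lineC a b x : a.1 != b.1 -> line a b x = line b a x.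
Proof.
move=> ab; rewrite /line [slope b a]slopeC /slope; field.
by rewrite subr_eq0 eq_sym.
Qed.

Lemma line_l a b : line a b a.1 = a.2.
Proof. by rewrite /line subrr mulr0 addr0. Qed.

Lemma line_r a b : a.1 != b.1 -> line a b b.1 = b.2.
Proof. by move=> ab; rewrite lineC // line_l. Qed.

Lemma line_diff a b c d x y :
  line c d x - line a b x =
  line c d y - line a b y + (slope c d - slope a b) * (x - y).
Proof. by rewrite /line; ring. Qed.

Definition btw a b (x : R) := (a.1 <= x <= b.1) || (b.1 <= x <= a.1).
Definition sbtw a b (x : R) := (a.1 < x < b.1) || (b.1 < x < a.1).

Lemma btwC a b x : btw a b x = btw b a x. Proof. exact: orbC. Qed.
Lemma sbtwC a b x : sbtw a b x = sbtw b a x. Proof. exact: orbC. Qed.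

(** Segments are graphs of affine functions over intervals of abscissae, so a common point is an
    abscissa where both functions agree. *)
Definition noncrossing a b c d := forall x, btw a b x -> btw c d x ->
  line a b x = line c d x -> (x = a.1 \/ x = b.1) /\ (x = c.1 \/ x = d.1).

Lemma noncrossingCl a b c d : a.1 != b.1 -> noncrossing a b c d -> noncrossing b a c d.
Proof.
move=> ab nc x; rewrite btwC -lineC // => h1 h2 h3.
by have [[->|->] ?] := nc x h1 h2 h3; split; auto.
Qed.

Lemma noncrossingC a b c d : noncrossing a b c d -> noncrossing c d a b.
Proof. by move=> nc x h1 h2 /esym h3; have [] := nc x h2 h1 h3. Qed.

(* Counterclockwise order, starting from the downward direction, of the
   directions of the segments [v, t] and [v, u] around [v]. *)
Definition dle v t u :=
  ((v.1 <= t.1) && (u.1 < v.1)) ||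
  (((t.1 < v.1) == (u.1 < v.1)) && (slope v t <= slope v u)).

Lemma dle_refl v t : dle v t t.
Proof. by rewrite /dle eqxx lexx orbT. Qed.

Lemma dle_total v : total (dle v).
Proof.
move=> t u; rewrite /dle ![_ <= _.1]leNgt.
by case: (t.1 < v.1); case: (u.1 < v.1); rewrite //= ?le_total.
Qed.

Lemma dle_trans v : transitive (dle v).
Proof.
move=> u t w; rewrite /dle ![_ <= _.1]leNgt.
by case: (t.1 < v.1); case: (u.1 < v.1); case: (w.1 < v.1); rewrite //=; apply: le_trans.
Qed.

Lemma dle_anti v t u : v.1 != t.1 -> v.1 != u.1 ->
  noncrossing v t v u -> dle v t u -> dle v u t -> False.
Proof.
move=> vt vu nc; rewrite /dle ![_ <= _.1]leNgt [(u.1 < _) == _]eq_sym.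
have [tl|/le_gtF tl] := ltP t.1 v.1; have [ul|/le_gtF ul] := ltP u.1 v.1 => //=.
  move=> h1 h2; have es : slope v t = slope v u by apply/le_anti; rewrite h1.
  have [tu|ut] := leP t.1 u.1.
    have [|||[] e _] := nc ((v.1 + u.1) / 2); rewrite /btw ?/line ?es //; lra.
  have [|||[] e _] := nc ((v.1 + t.1) / 2); rewrite /btw ?/line ?es //; lra.
have {tl} : v.1 < t.1 by rewrite lt_neqAle vt leNgt tl.
have {ul} : v.1 < u.1 by rewrite lt_neqAle vu leNgt ul.
move=> ul tl h1 h2; have es : slope v t = slope v u by apply/le_anti; rewrite h1.
have [tu|ut] := leP t.1 u.1.
  have [|||[] e _] := nc ((v.1 + t.1) / 2); rewrite /btw ?/line ?es //; lra.
have [|||[] e _] := nc ((v.1 + u.1) / 2); rewrite /btw ?/line ?es //; lra.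
Qed.

(* The contribution of the segment [c, d] to the parity of the region on the
   left of the segment from [a] to [b], seen from [a]: crossings of the upward
   vertical ray from [a], then a turn around [a]. *)
Definition ray c d a := (sbtw c d a.1 && (a.2 < line c d a.1)) (+)
  (((c == a) && (c.1 < d.1)) (+) ((d == a) && (d.1 < c.1))).
Definition turn c d a b :=
  ((c == a) && dle a d b) (+) ((d == a) && dle a c b).
Definition side c d a b := ray c d a (+) turn c d a b.

Definition above a b v := sbtw a b v.1 && (line a b v.1 < v.2).

Lemma sideC c d a b : c.1 != d.1 -> side c d a b = side d c a b.
Proof.
move=> cd; rewrite /side /ray /turn sbtwC lineC //; congr (_ (+) _); last exact: addbC.
by congr (_ (+) _); exact: addbC.
Qed.

Lemma aboveC a b v : a.1 != b.1 -> above a b v = above b a v.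
Proof. by move=> ab; rewrite /above sbtwC lineC. Qed.

Lemma side_right a b c d : a.1 < b.1 -> c.1 < d.1 ->
  side c d a b = ((c.1 < a.1 < d.1) && (a.2 < line c d a.1)) (+)
                 ((c == a) && (slope a b < slope c d)).
Proof.
move=> ab cd; rewrite /side /ray /turn /sbtw cd (lt_gtF cd) andbT andbF addbF.
have -> : (d.1 < a.1 < c.1) = false by apply/negP; lra.
rewrite orbF -addbA; congr (_ (+) _).
have -> : (d == a) && dle a c b = false.
  apply/negP => /andP[/eqP e]; rewrite -e in ab *.
  by rewrite /dle leNgt cd (lt_gtF ab).
rewrite addbF; case: eqP => //= e; rewrite -e in ab *.
by rewrite /dle (lt_gtF ab) (lt_gtF cd) ltNge andbF.
Qed.

Lemma side_left a b c d : a.1 < b.1 -> c.1 < d.1 ->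
  side c d b a = ((c.1 < b.1 < d.1) && (b.2 < line c d b.1)) (+)
                 ((d == b) && (slope c d <= slope a b)).
Proof.
move=> ab cd; rewrite /side /ray /turn /sbtw cd (lt_gtF cd) andbT andbF addbF.
have -> : (d.1 < b.1 < c.1) = false by apply/negP; lra.
rewrite orbF -addbA; congr (_ (+) _).
have -> : (c == b) && dle b d a = (c == b).
  by case: eqP => //= e; rewrite -e in ab *; rewrite /dle ab (ltW cd).
rewrite addbA addbb addFb; case: eqP => //= e.
by rewrite -e in ab *; rewrite /dle ab cd /= [slope d c]slopeC [slope d a]slopeC leNgt cd.
Qed.

(** A segment separates its own two sides. *)
Lemma side_self a b : a.1 != b.1 -> side a b a b (+) side a b b a = true.
Proof.
wlog ab : a b / a.1 < b.1 => [hw|_].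
  move=> ab; have [/hw/(_ ab)//|ba|e] := ltgtP a.1 b.1; last by rewrite e eqxx in ab.
  by rewrite addbC [side a b b a]sideC // [side a b a b]sideC // hw // eq_sym.
by rewrite side_right // side_left // !ltxx !eqxx ab lexx.
Qed.

Lemma affine_sign (f : R -> R) (k lo hi : R) : lo < hi ->
  (forall x y, f x = f y + k * (x - y)) ->
  (forall x, lo < x < hi -> f x <> 0) ->
  f lo != 0 -> f hi != 0 -> (0 < f lo) = (0 < f hi).
Proof.
move=> lohi fE nz l0 h0.
have [l|l|e] := ltgtP 0 (f lo); have [h|h|e'] := ltgtP 0 (f hi) => //.
- have k0 : 0 < f lo - f hi by lra.
  (* The zero of [f] is located by linear interpolation. *)
  case: (nz (lo + (hi - lo) * (f lo / (f lo - f hi)))).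
    have := fE hi lo.
    have ? : 0 < f lo / (f lo - f hi) by apply: divr_gt0.
    have ? : f lo / (f lo - f hi) < 1 by rewrite ltr_pdivrMr // mul1r; lra.
    nra.
  rewrite (fE (_ + _) lo) [lo + _]addrC addrK mulrA.
  have -> : k * (hi - lo) = f hi - f lo by rewrite (fE hi lo); ring.
  by field; lra.
- by rewrite -e' eqxx in h0.
- have k0 : 0 < f hi - f lo by lra.
  case: (nz (lo + (hi - lo) * (- f lo / (f hi - f lo)))).
    have := fE hi lo.
    have ? : 0 < - f lo / (f hi - f lo) by apply: divr_gt0; lra.
    have ? : - f lo / (f hi - f lo) < 1 by rewrite ltr_pdivrMr // mul1r; lra.
    nra.
  rewrite (fE (_ + _) lo) [lo + _]addrC addrK mulrA.
  have -> : k * (hi - lo) = f hi - f lo by rewrite (fE hi lo); ring.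
  by field; lra.
- by rewrite -e eqxx in l0.
Qed.

(** As the upward ray slides along [a, b], it gains or loses [c, d] only where an end of [c, d] lies
    above [a, b]: the difference of the two affine functions keeps its sign over the common
    abscissae. *)
Lemma side_noncrossing a b c d : a.1 != b.1 -> c.1 != d.1 ->
  (a.1 = c.1 -> a = c) -> (a.1 = d.1 -> a = d) ->
  (b.1 = c.1 -> b = c) -> (b.1 = d.1 -> b = d) ->
  noncrossing a b c d ->
  side c d a b (+) side c d b a = above a b c (+) above a b d.
Proof.
wlog ab : a b / a.1 < b.1 => [hw|_].
  move=> ab cd h1 h2 h3 h4 nc.
  have [/hw|ba|e] := ltgtP a.1 b.1; [exact| |by rewrite e eqxx in ab].
  rewrite addbC (aboveC c ab) (aboveC d ab).
  by apply: hw => //; [rewrite eq_sym|apply: noncrossingCl].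
wlog cd : c d / c.1 < d.1 => [hw|_].
  move=> cd h1 h2 h3 h4 nc.
  have [/hw|dc|e] := ltgtP c.1 d.1; [exact| |by rewrite e eqxx in cd].
  rewrite [RHS]addbC (sideC _ _ cd) (sideC _ _ cd).
  apply: hw => //; first by rewrite eq_sym.
  by apply/noncrossingC/noncrossingCl => //; apply/noncrossingC.
move=> eac ead ebc ebd nc; rewrite side_right // side_left // /above.
have sb x : sbtw a b x = (a.1 < x < b.1).
  rewrite /sbtw; have -> : (b.1 < x < a.1) = false by apply/negP; lra.
  exact: orbF.
rewrite !{}sb.
pose f x := line c d x - line a b x.
have fE x y : f x = f y + (slope c d - slope a b) * (x - y) by exact: line_diff.
have fN0 x : a.1 <= x <= b.1 -> c.1 <= x <= d.1 ->
    ~ ((x = a.1 \/ x = b.1) /\ (x = c.1 \/ x = d.1)) -> f x <> 0.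
  move=> hx hx' ne /eqP; rewrite subr_eq0 => /eqP/esym e.
  by apply/ne/nc => //; rewrite /btw ?hx ?hx'.
have fc x : f x = line c d x - line a b x by [].
have e1 : (c == a) = (c.1 == a.1).
  by apply/eqP/eqP => [->//|/esym/eac].
have e2 : (d == b) = (d.1 == b.1).
  by apply/eqP/eqP => [->//|/esym/ebd].
rewrite e1 e2.
have la : line a b a.1 = a.2 by exact: line_l.
have lb : line a b b.1 = b.2 by apply: line_r; rewrite lt_eqF.
have lc : line c d c.1 = c.2 by exact: line_l.
have ld : line c d d.1 = d.2 by apply: line_r; rewrite lt_eqF.
have [da|ad] : d.1 <= a.1 \/ a.1 < d.1 by case: leP; auto.
  have -> : (c.1 < a.1 < d.1) = false by apply/negP; lra.
  have -> : (c.1 < b.1 < d.1) = false by apply/negP; lra.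
  have -> : (a.1 < c.1 < b.1) = false by apply/negP; lra.
  have -> : (a.1 < d.1 < b.1) = false by apply/negP; lra.
  have -> : (c.1 == a.1) = false by apply/eqP; lra.
  by have -> : (d.1 == b.1) = false by apply/eqP; lra.
have [bc|cb] : b.1 <= c.1 \/ c.1 < b.1 by case: leP; auto.
  have -> : (c.1 < a.1 < d.1) = false by apply/negP; lra.
  have -> : (c.1 < b.1 < d.1) = false by apply/negP; lra.
  have -> : (a.1 < c.1 < b.1) = false by apply/negP; lra.
  have -> : (a.1 < d.1 < b.1) = false by apply/negP; lra.
  have -> : (c.1 == a.1) = false by apply/eqP; lra.
  by have -> : (d.1 == b.1) = false by apply/eqP; lra.
have sgn l h : l < h -> a.1 <= l -> c.1 <= l -> h <= b.1 -> h <= d.1 ->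
  f l != 0 -> f h != 0 -> (0 < f l) = (0 < f h).
  move=> lh al cl hb hd; apply: affine_sign fE _ => // x hx.
  by apply: fN0; lra.
have Ha : (a.2 < line c d a.1) = (0 < f a.1) by rewrite fc la subr_gt0.
have Hb : (b.2 < line c d b.1) = (0 < f b.1) by rewrite fc lb subr_gt0.
have Hc : (line a b c.1 < c.2) = (0 < f c.1) by rewrite fc lc subr_gt0.
have Hd : (line a b d.1 < d.2) = (0 < f d.1) by rewrite fc ld subr_gt0.
have kl h : c.1 = a.1 -> a.1 < h -> (slope a b < slope c d) = (0 < f h).
  move=> /esym ca ah; have f0 : f a.1 = 0 by rewrite fc la [in line c d _]ca lc (eac ca) subrr.
  by rewrite (fE h a.1) f0 add0r pmulr_lgt0 ?subr_gt0.
have kr l : d.1 = b.1 -> l < b.1 -> f l != 0 -> (slope c d <= slope a b) = (0 < f l).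
  move=> /esym db lb' fl; have f0 : f b.1 = 0 by rewrite fc lb [in line c d _]db ld (ebd db) subrr.
  have e : f l = (slope a b - slope c d) * (b.1 - l) by rewrite (fE l b.1) f0; ring.
  rewrite e pmulr_lgt0 ?subr_gt0 // le_eqVlt; case: eqP => //= e'.
  by rewrite e e' subrr mul0r eqxx in fl.
rewrite {}Ha {}Hb {}Hc {}Hd.
case: (ltgtP c.1 a.1) => ca; case: (ltgtP d.1 b.1) => db; rewrite ?ad ?cb ?andbT ?andbF /= ?addbF.
- by apply: sgn => //; try lra; apply/eqP/fN0; lra.
- have -> : (0 < f a.1) = (0 < f b.1) by apply: sgn => //; try lra; apply/eqP/fN0; lra.
  exact: addbb.
- rewrite (kr a.1) //; first exact: addbb.
  by apply/eqP/fN0; lra.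
- have -> : (0 < f c.1) = (0 < f d.1) by apply: sgn => //; try lra; apply/eqP/fN0; lra.
  by rewrite addbb.
- by apply/esym/sgn => //; try lra; apply/eqP/fN0; lra.
- by rewrite (kr c.1) //; apply/eqP/fN0; lra.
- by rewrite (kl d.1).
- by rewrite (kl b.1) // addbb.
(* Both segments have the same ends, so their midpoint would be a forbidden common point. *)
exfalso; have m : a.1 < (a.1 + b.1) / 2 < b.1 by lra.
apply: (fN0 ((a.1 + b.1) / 2)); try lra.
by rewrite /f (eac (esym ca)) (ebd (esym db)) subrr.
Qed.

End Segments.

(** * The rotation system of a polygonal drawing *)

Lemma big_addb_telescope (f : nat -> bool) m :
  \big[addb/false]_(0 <= i < m) (f i (+) f i.+1) = f 0 (+) f m.
Proof.
elim: m => [|m IH]; first by rewrite big_geq // addbb.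
by rewrite big_nat_recr //= IH -addbA addKb.
Qed.

Lemma big_addb_delta (c : bool) j m : j < m ->
  \big[addb/false]_(0 <= i < m) ((i == j) && c) = c.
Proof.
move=> jm; rewrite (eq_bigr (fun i => if i == j then c else false)) => [|i _].
  by rewrite -big_mkcond big_nat1_eq jm.
by case: (i == j).
Qed.

(* Edge [e] is drawn as the polygonal line [p e 0, ..., p e (n e).+1]. *)
Record polydrawing (R : realFieldType) (G : sgraph) (pos : G -> R * R)
    (n : G * G -> nat) (p : G * G -> nat -> R * R) : Prop := PolyDrawing {
  pd_inj : injective pos;
  pd_first : forall e, oriented G e -> p e 0 = pos e.1;
  pd_last : forall e, oriented G e -> p e (n e).+1 = pos e.2;
  pd_bend : forall e i z, oriented G e -> 0 < i <= n e -> p e i <> pos z;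
  pd_simple : forall e i j, oriented G e -> i <= (n e).+1 -> j <= (n e).+1 ->
    p e i = p e j -> i = j;
  pd_disjoint : forall e i e' i', oriented G e -> oriented G e' ->
    0 < i <= n e -> i' <= (n e').+1 -> p e i = p e' i' -> e = e';
  pd_abscissa : forall e i e' i', oriented G e -> oriented G e' ->
    i <= (n e).+1 -> i' <= (n e').+1 -> (p e i).1 = (p e' i').1 -> p e i = p e' i';
  pd_noncrossing : forall e i e' i', oriented G e -> oriented G e' ->
    i <= n e -> i' <= n e' -> (e, i) <> (e', i') ->
    noncrossing (p e i) (p e i.+1) (p e' i') (p e' i'.+1) }.

Section Drawing.
Variables (R : realFieldType) (G : sgraph) (pos : G -> R * R).
Variables (n : G * G -> nat) (p : G * G -> nat -> R * R).
Hypothesis drawn : polydrawing pos n p.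

Lemma pd_abs_neq e i : oriented G e -> i <= n e -> (p e i).1 != (p e i.+1).1.
Proof.
move=> oe ie; have ie' : i < (n e).+1 by [].
apply/eqP => /(pd_abscissa drawn oe oe (leqW ie) ie').
by move/(pd_simple drawn oe (leqW ie) ie')/n_Sn.
Qed.

Lemma pd_vertex e i z : oriented G e -> i <= (n e).+1 -> p e i = pos z ->
  (i = 0 /\ z = e.1) \/ (i = (n e).+1 /\ z = e.2).
Proof.
move=> oe ie h; case: (posnP i) => [i0|ip].
  by left; split=> //; apply: (pd_inj drawn); rewrite -h i0 (pd_first drawn).
case: (leqP i (n e)) => [ie'|ie'].
  by have := pd_bend drawn (z := z) oe _ h; rewrite ip ie' => /(_ isT).
have {}ie : i = (n e).+1 by apply/eqP; rewrite eqn_leq ie ie'.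
by right; split=> //; apply: (pd_inj drawn); rewrite -h ie (pd_last drawn).
Qed.

(** The corner of the polygonal line that follows [pos x] on the way to [y]; it fixes the direction
    in which the edge leaves [x]. *)
Definition tip (x y : G) :=
  if enum_rank x < enum_rank y then p (x, y) 1 else p (y, x) (n (y, x)).

Section Parity.
Variable Z : rel G.
Hypotheses (Zsym : symmetric Z) (Zadj : subrel Z adj).
Hypothesis Zeven : forall x, \big[addb/false]_y Z x y = false.

Let XS (F : G * G -> nat -> bool) := \big[addb/false]_(e | oriented G e)
  (Z e.1 e.2 && \big[addb/false]_(0 <= i < (n e).+1) F e i).

Let XSD F F' : XS F (+) XS F' = XS (fun e i => F e i (+) F' e i).
Proof.
rewrite -big_split /=; apply: eq_bigr => e _; rewrite -andb_addr.
by rewrite -big_split.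
Qed.

Let eqXS F F' : (forall e i, oriented G e -> i <= n e -> F e i = F' e i) ->
  XS F = XS F'.
Proof.
move=> eF; apply: eq_bigr => e oe; congr (_ && _).
by apply: eq_big_nat => i ie; apply: eF.
Qed.

Let XS1 e F : oriented G e -> (forall e' i, e' != e -> F e' i = false) ->
  XS F = Z e.1 e.2 && \big[addb/false]_(0 <= i < (n e).+1) F e i.
Proof.
move=> oe F0; rewrite /XS (bigD1 e) //= [X in _ (+) X]big1 ?addbF // => e' /andP[_ ne].
by rewrite big1 ?andbF // => i _; apply: F0.
Qed.

(** Along each edge the sum telescopes to its two ends, and every vertex is an end of evenly many
    edges of [Z]. *)
Lemma sum_endpoints (P : R * R -> bool) :
  XS (fun e i => P (p e i) (+) P (p e i.+1)) = false.
Proof.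
rewrite /XS (eq_bigr (fun e =>
  (Z e.1 e.2 && P (pos e.1)) (+) (Z e.2 e.1 && P (pos e.2)))) => [|e oe].
  rewrite (addb_oriented (F := fun x y => Z x y && P (pos x))).
    rewrite big1 // => x _; rewrite -big_distrl /= Zeven //.
  by move=> x y nxy; rewrite (contraNF (@Zadj x y)).
rewrite big_addb_telescope (pd_first drawn) // (pd_last drawn) //.
by rewrite [Z e.2 _]Zsym -andb_addr.
Qed.

(** The parity of crossings with [Z] of the region on the left of the segment from [a] to [b]. *)
Definition left_parity (a b : R * R) := XS (fun e i => side (p e i) (p e i.+1) a b).

(** By [side_noncrossing] the other segments contribute terms in [above] at their ends, which cancel
    by [sum_endpoints]; what remains is the segment itself. *)
Lemma left_parity_rev e j : oriented G e -> j <= n e ->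
  left_parity (p e j) (p e j.+1) (+) left_parity (p e j.+1) (p e j) = Z e.1 e.2.
Proof.
move=> oe je; rewrite XSD.
set a := p e j; set b := p e j.+1.
have ab : a.1 != b.1 by exact: pd_abs_neq.
rewrite (eqXS (F' := fun e' i => (above a b (p e' i) (+) above a b (p e' i.+1))
   (+) ((e' == e) && (i == j)))).
  rewrite -XSD sum_endpoints addFb (XS1 oe) => [|e' i /negPf->//].
  under eq_bigr do rewrite eqxx andTb -[_ == _]andbT.
  by rewrite big_addb_delta // andbT.
move=> e' i oe' ie'; case: (eqVneq e' e) => [ee|ne]; last first.
  rewrite addbF; apply: side_noncrossing => //; try exact: pd_abs_neq.
  1-4: by apply: (pd_abscissa drawn) => //; rewrite ?leqW.
  by apply: (pd_noncrossing drawn) => // -[e1]; rewrite e1 eqxx in ne.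
case: (eqVneq i j) => [ij|ne] /=.
  rewrite ee ij side_self // /above /sbtw !ltxx !andbF //.
rewrite addbF; apply: side_noncrossing => //; try exact: pd_abs_neq.
1-4: by apply: (pd_abscissa drawn) => //; rewrite ?leqW.
by apply: (pd_noncrossing drawn) => // -[_ e1]; rewrite e1 eqxx in ne.
Qed.

Lemma left_parity_turn a : exists k : bool, forall b,
  left_parity a b = k (+) XS (fun e i => turn (p e i) (p e i.+1) a b).
Proof.
by exists (XS (fun e i => ray (p e i) (p e i.+1) a)) => b; rewrite XSD.
Qed.

(** The only segments at a bend are the two of its own edge, so turning around it from one to the
    other crosses the edge once. *)
Lemma left_parity_bend e j : oriented G e -> j < n e ->
  left_parity (p e j.+1) (p e j.+2) = left_parity (p e j.+1) (p e j) (+) Z e.1 e.2.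
Proof.
move=> oe je; have [k kP] := left_parity_turn (p e j.+1).
rewrite !kP -addbA; congr (_ (+) _); apply: (canRL (addKb _)).
rewrite XSD.
set u := p e j; set v := p e j.+1; set w := p e j.+2.
have uv : v.1 != u.1 by rewrite eq_sym; apply: pd_abs_neq (ltnW je).
have vw : v.1 != w.1 by exact: pd_abs_neq.
have dd : dle v u w (+) dle v w u = true.
  have nc : noncrossing v u v w.
    apply: noncrossingCl; first by rewrite eq_sym.
    apply: (pd_noncrossing drawn) => //; first exact: ltnW.
    by case=> /n_Sn.
  have := dle_anti uv vw nc; have := dle_total v u w.
  by case: (dle v u w); case: (dle v w u) => //= _ /(_ isT isT).
rewrite (eqXS (F' := fun e' i => (e' == e) && (((i == j) && ~~ dle v u w) (+)
   ((i == j.+1) && ~~ dle v w u)))).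
  rewrite (XS1 oe) => [|e' i /negPf->//].
  under eq_bigr do rewrite eqxx andTb.
  rewrite big_split /= !big_addb_delta ?ltnS //; last exact: ltnW.
  by move: dd; case: (dle v u w); case: (dle v w u) => //; rewrite andbT.
move=> e' i oe' ie'; rewrite /turn.
have pv i' : i' <= (n e').+1 -> (p e' i' == v) = (e' == e) && (i' == j.+1).
  move=> hi; apply/eqP/andP => [h|[/eqP-> /eqP->//]].
  have ee : e = e' by apply: (pd_disjoint drawn oe oe' _ hi (esym h)).
  split; first by rewrite ee.
  have jj : j.+1 <= (n e').+1 by rewrite -ee ltnS ltnW.
  by apply/eqP; apply: (pd_simple drawn oe' hi jj); rewrite h -ee.
rewrite (pv i) ?leqW // (pv i.+1) // eqSS; case: (eqVneq e' e) => [->|//] /=.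
case: (eqVneq i j) => [->|ne] /=.
  have -> : (j == j.+1) = false by lia.
  rewrite -/u dle_refl /=; by case: (dle v u w).
case: (eqVneq i j.+1) => [->|//] /=.
by rewrite -/w dle_refl; case: (dle v w u).
Qed.

Lemma left_parity_arc e : oriented G e ->
  left_parity (pos e.1) (p e 1) (+) left_parity (pos e.2) (p e (n e)) = Z e.1 e.2.
Proof.
move=> oe; rewrite -(pd_first drawn oe) -(pd_last drawn oe).
suff -> : left_parity (p e 0) (p e 1) = left_parity (p e (n e)) (p e (n e).+1).
  exact: left_parity_rev.
have: n e <= n e by []; move: {1 3 4}(n e) => m.
elim: m => // m IH mn; rewrite IH ?(ltnW mn) // left_parity_bend //.
by rewrite -(left_parity_rev oe (ltnW mn)) addbC addbK.
Qed.

Lemma left_parity_tip x y : adj x y ->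
  left_parity (pos x) (tip x y) (+) left_parity (pos y) (tip y x) = Z x y.
Proof.
move=> axy; rewrite /tip; case: ltngtP => [lt|gt|/val_inj/enum_rank_inj e].
- by apply: (left_parity_arc (e := (x, y))); rewrite /oriented /= axy lt.
- rewrite addbC Zsym; apply: (left_parity_arc (e := (y, x))).
  by rewrite /oriented /= adj_sym axy gt.
- by rewrite e adj_irrefl in axy.
Qed.

Lemma left_parity_vertex x : exists k : bool, forall b,
  left_parity (pos x) b =
  k (+) \big[addb/false]_z (Z x z && dle (pos x) (tip x z) b).
Proof.
have [k kP] := left_parity_turn (pos x); exists k => b; rewrite kP; congr (_ (+) _).
pose F y z := (y == x) && (Z y z && dle (pos x) (tip y z) b).
have -> : \big[addb/false]_z (Z x z && dle (pos x) (tip x z) b) =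
    \big[addb/false]_y \big[addb/false]_z F y z.
  rewrite [RHS](bigD1 x) //= [X in _ (+) X]big1 => [|y /negPf yx]; last first.
    by rewrite big1 // /F yx.
  by rewrite addbF /F eqxx.
rewrite -addb_oriented => [|y z nyz]; last first.
  by rewrite /F (contraNF (@Zadj y z)) // andbF.
apply: eq_bigr => e oe; rewrite /F [Z e.2 _]Zsym.
case: (Z _ _) => /=; last by rewrite !andbF.
have pv i : i <= (n e).+1 -> (p e i == pos x) =
    ((i == 0) && (e.1 == x)) || ((i == (n e).+1) && (e.2 == x)).
  move=> hi; apply/eqP/orP => [/(pd_vertex oe hi) [[-> ->]|[-> ->]]|].
  - by left; rewrite !eqxx.
  - by right; rewrite !eqxx.
  - by case=> /andP[/eqP-> /eqP<-]; rewrite ?(pd_first drawn) ?(pd_last drawn).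
have /andP[/= _ lt] := oe.
rewrite /turn big_split /=; congr (_ (+) _).
- rewrite (eq_big_nat _ _ (F2 := fun i => (i == 0) && ((e.1 == x) && dle (pos x) (tip e.1 e.2) b))).
    by rewrite big_addb_delta.
  move=> i /= ie; rewrite pv ?leqW //.
  have -> : (i == (n e).+1) = false by lia.
  rewrite orbF -andbA; case: eqP => //= ->.
  by rewrite /tip lt -surjective_pairing.
- rewrite (eq_big_nat _ _ (F2 := fun i => (i == n e) && ((e.2 == x) && dle (pos x) (tip e.2 e.1) b))).
    by rewrite big_addb_delta.
  move=> i /= ie; rewrite pv // eqSS /= -andbA; case: eqP => //= ->.
  by rewrite /tip ltnNge (ltnW lt) /= -surjective_pairing.
Qed.

End Parity.

Lemma tip_segment x y : adj x y -> exists e i, [/\ oriented G e, i <= n e,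
  e = (x, y) \/ e = (y, x) &
  (p e i = pos x /\ p e i.+1 = tip x y) \/ (p e i.+1 = pos x /\ p e i = tip x y)].
Proof.
move=> axy; rewrite /tip; case: ltngtP => [lt|gt|/val_inj/enum_rank_inj e].
- have oe : oriented G (x, y) by rewrite /oriented /= axy.
  by exists (x, y), 0; split; auto; left; rewrite (pd_first drawn).
- have oe : oriented G (y, x) by rewrite /oriented /= adj_sym axy.
  by exists (y, x), (n (y, x)); split; auto; right; rewrite (pd_last drawn).
- by rewrite e adj_irrefl in axy.
Qed.

Lemma tip_anti x y z : adj x y -> adj x z ->
  dle (pos x) (tip x y) (tip x z) -> dle (pos x) (tip x z) (tip x y) -> y = z.
Proof.
move=> axy axz d1 d2; apply/eqP/negPn/negP => /eqP yz.
have [e [i [oe ie eE hi]]] := tip_segment axy.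
have [e' [i' [oe' ie' eE' hi']]] := tip_segment axz.
have ne : (e, i) <> (e', i').
  move=> [ee _]; move: eE eE'; rewrite -ee.
  by case=> -> [] [] *; subst; rewrite ?adj_irrefl in axy axz.
have nc := pd_noncrossing drawn oe oe' ie ie' ne.
have a1 := pd_abs_neq oe ie; have a2 := pd_abs_neq oe' ie'.
have nc1 : noncrossing (pos x) (tip x y) (p e' i') (p e' i'.+1).
  by case: hi => -[<- <-] //; apply: noncrossingCl.
have h1 : (pos x).1 != (tip x y).1 by case: hi => -[<- <-] //; rewrite eq_sym.
have h2 : (pos x).1 != (tip x z).1 by case: hi' => -[<- <-] //; rewrite eq_sym.
apply: (dle_anti h1 h2) => //.
case: hi' => -[e1 e2]; rewrite e1 e2 in nc1 a2 => //.
by apply/noncrossingC/noncrossingCl => //; apply/noncrossingC.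
Qed.

Definition rotation x : seq G :=
  sort (fun y z => dle (pos x) (tip x y) (tip x z)) (enum [pred y | adj x y]).

Lemma rotation_uniq x : uniq (rotation x).
Proof. by rewrite sort_uniq enum_uniq. Qed.

Lemma mem_rotation x y : (y \in rotation x) = adj x y.
Proof. by rewrite mem_sort mem_enum. Qed.

(** At [y], the left of the dart from [x] to [y] is the sector between the edge to [x] and the edge
    preceding it counterclockwise. No edge leaves [y] inside this sector, so it is also the left of
    the next dart of the face. *)
Lemma rotation_separating : separating rotation.
Proof.
move=> Z Zsym Zadj Zeven.
exists (fun x y => left_parity Z (pos x) (tip x y)); split=> x y axy.
  exact: left_parity_tip.
suff <- : left_parity Z (pos y) (tip y x) (+) Z y x =
    left_parity Z (pos y) (tip y (prev (rotation y) x)).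
  by rewrite Zsym -(left_parity_tip Zsym Zadj Zeven axy) addbC addbK.
have [k kP] := left_parity_vertex Zsym Zadj y; rewrite !{}kP -addbA.
congr (_ (+) _); set s := rotation y.
have su : uniq s by exact: rotation_uniq.
(* In the sorted list, the directions up to that of [w] form a prefix. *)
have sumE w : w \in s -> \big[addb/false]_z (Z y z && dle (pos y) (tip y z) (tip y w)) =
    \big[addb/false]_(0 <= i < size s) (Z y (nth y s i) && (i <= index w s)).
  move=> ws; rewrite (bigID (mem s)) /= [X in _ (+) X]big1 => [|z]; last first.
    by rewrite mem_rotation => nyz; rewrite (contraNF (@Zadj y z)).
  rewrite addbF -(big_uniq _ su) (big_nth y) /=.
  apply: eq_big_nat => i /= ie; congr (_ && _).
  have wi : index w s < size s by rewrite index_mem.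
  have st : sorted (fun y0 z => dle (pos y) (tip y y0) (tip y z)) s.
    by apply: sort_sorted => u v; apply: dle_total.
  have le_nth i1 i2 : i1 < size s -> i2 < size s -> i1 <= i2 ->
      dle (pos y) (tip y (nth y s i1)) (tip y (nth y s i2)).
    move=> h1 h2 h12; apply: (sorted_leq_nth _ _ _ st) => //.
      by move=> a b c; apply: dle_trans.
    by move=> a; apply: dle_refl.
  rewrite -{1}(nth_index y ws); apply/idP/idP => [d|h]; last exact: le_nth.
  rewrite leqNgt; apply/negP => lt.
  have e : nth y s i = nth y s (index w s).
    apply: (tip_anti (x := y)) => //; rewrite -?mem_rotation ?mem_nth //.
    by apply: le_nth => //; apply: ltnW.
  by move/eqP: e; rewrite nth_uniq // => /eqP e; rewrite e ltnn in lt.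
have sumS m : m < size s ->
    \big[addb/false]_(0 <= i < size s) (Z y (nth y s i) && (i <= m)) =
    \big[addb/false]_(0 <= i < m.+1) Z y (nth y s i).
  move=> ms; rewrite (big_cat_nat (n := m.+1)) //= [X in _ (+) X]big_nat_cond.
  rewrite [X in _ (+) X]big1 ?addbF => [|i /andP[/andP[mi _] _]]; last first.
    by rewrite leqNgt mi andbF.
  by apply: eq_big_nat => i /= im; rewrite -ltnS im andbT.
have xs : x \in s by rewrite mem_rotation adj_sym.
have ps : prev s x \in s by rewrite mem_prev.
rewrite !sumE // !sumS ?index_mem //.
(* Evenness at [y] closes the circle: if [x] is first in [s], its predecessor is the last element
   and the prefix is the whole list. *)
have tot : \big[addb/false]_(0 <= i < size s) Z y (nth y s i) = false.
  rewrite -(big_nth y xpredT (fun z => Z y z)) (big_uniq _ su) -[RHS](Zeven y).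
  rewrite [RHS](bigID (mem s)) /= [X in _ (+) X]big1 ?addbF // => z.
  by rewrite mem_rotation => nyz; rewrite (contraNF (@Zadj y z)).
have eZ : Z y x = Z y (nth y s (index x s)) by rewrite nth_index.
rewrite eZ big_nat_recr //= addbK.
move: xs tot; rewrite prev_nth => xs; rewrite xs; move: su xs; clear.
case: s => // h q hq xs.
have [<-|hx] := eqVneq h x.
  have -> : index h (h :: q) = 0 by rewrite /= eqxx.
  have -> : index h q = size q by apply: memNindex; case/andP: hq.
  by rewrite index_uniq // [size (h :: q)]/= => ->; rewrite big_geq.
have -> : index x (h :: q) = (index x q).+1 by rewrite /= (negPf hx).
by rewrite index_uniq // /= ltnS index_size.
Qed.

End Drawing.

(** * Shearing a drawing into general position *)

Section Shear.
Variable R : realType.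
Local Open Scope ring_scope.
Implicit Types a b z : (R * R)%type.

Definition shear (eps : R) a : R * R := (a.1 + eps * a.2, a.2).

Lemma shear_inj eps : injective (shear eps).
Proof. by move=> [a1 a2] [b1 b2] [/= + e]; rewrite e => /addIr ->. Qed.

(** Two points of different ordinates get the same abscissa for a single value of [eps], whose
    absolute value is [bad]; one more than the sum over all pairs exceeds every such value. *)
Lemma exists_shear (s : seq (R * R)) : exists eps, forall a b, a \in s -> b \in s ->
  (shear eps a).1 = (shear eps b).1 -> a = b.
Proof.
pose bad (q : (R * R) * (R * R)) := `|(q.2.1 - q.1.1) / (q.1.2 - q.2.2)|.
pose eps := 1 + \sum_(q <- [seq (a, b) | a <- s, b <- s]) bad q.
exists eps => a b sa sb /= e.
have [e2|ne2] := eqVneq a.2 b.2.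
  by move: a b e e2 {sa sb} => [a1 a2] [b1 b2] /= + e2; rewrite e2 => /addIr->.
have ltb : bad (a, b) < eps.
  have ab : (a, b) \in [seq (a, b) | a <- s, b <- s] by apply: allpairs_f.
  rewrite /eps (big_rem _ ab) /=.
  have : 0 <= \sum_(q <- rem (a, b) [seq (a, b) | a <- s, b <- s]) bad q.
    by apply: sumr_ge0 => q _; apply: normr_ge0.
  lra.
have : bad (a, b) = `|eps|.
  congr `|_|; apply: (mulIf (x := a.2 - b.2)); first by rewrite subr_eq0.
  rewrite mulfVK ?subr_eq0 //=; lra.
have := ler_norm eps; move=> h1 h2; exfalso; lra.
Qed.

Lemma segment_line a b x : a.1 != b.1 -> btw a b x -> segment a b (x, line a b x).
Proof.
move=> ab h; exists ((x - a.1) / (b.1 - a.1)).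
  move: ab h; rewrite /btw; case: (ltgtP a.1 b.1) => // ab _ h.
    have p : 0 < b.1 - a.1 by lra.
    rewrite ler_pdivlMr // ler_pdivrMr //; lra.
  have p : 0 < a.1 - b.1 by lra.
  rewrite -[x - _]opprB -[b.1 - _]opprB invrN mulrNN ler_pdivlMr // ler_pdivrMr //; lra.
by rewrite /line /slope; congr (_, _); field; rewrite subr_eq0 eq_sym.
Qed.

Lemma segment_shear eps a b z :
  segment (shear eps a) (shear eps b) (shear eps z) -> segment a b z.
Proof.
case=> t t01 [/= e1 e2]; exists t => //; move: z e1 e2 => [z1 z2] /= e1 e2.
congr (_, _) => //; rewrite e2 in e1; lra.
Qed.

Lemma segment_l a b : segment a b a.
Proof. by exists 0; rewrite ?lexx ?ler01 //; case: a => a1 a2 /=; congr (_, _); ring. Qed.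

Lemma segment_r a b : segment a b b.
Proof. by exists 1; rewrite ?lexx ?ler01 //; case: b => a1 a2 /=; congr (_, _); ring. Qed.

End Shear.

(** * Self-intersections of polygonal arcs *)

Section PolygonalLine.
Variables (R : realType) (n : nat) (p : nat -> R * R).
Hypothesis neq : forall i, i <= n -> p i <> p i.+1.
Hypothesis cons : forall i, i < n ->
  (segment (p i) (p i.+1) `&` segment (p i.+1) (p i.+2) = [set p i.+1])%classic.
Hypothesis disj : forall i j, i.+1 < j <= n ->
  (segment (p i) (p i.+1) `&` segment (p j) (p j.+1) = classical_sets.set0)%classic.

Lemma polyline_meet i j z : i < j <= n ->
  segment (p i) (p i.+1) z -> segment (p j) (p j.+1) z -> j = i.+1 /\ z = p j.
Proof.
move=> /andP[ij jn] hi hj; case: (eqVneq j i.+1) => [e|ne].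
  have h := cons (leq_trans ij jn); rewrite -e in h; split=> //.
  have : (segment (p i) (p j) `&` segment (p j) (p j.+1))%classic z by split; rewrite // e.
  by rewrite h.
have ij' : i.+1 < j <= n by lia.
have : (segment (p i) (p i.+1) `&` segment (p j) (p j.+1))%classic z by [].
by rewrite (disj ij').
Qed.

Lemma polyline_simple i j : i <= n.+1 -> j <= n.+1 -> p i = p j -> i = j.
Proof.
wlog ij : i j / i < j => [hw|] hi hj e.
  by case: (ltngtP i j) => // h; [apply: hw|apply/esym/hw].
case: j => // j in ij hj e *; exfalso.
case: (eqVneq i j) => [ei|ne]; first by rewrite ei in e; apply: (neq _ e).
have ij' : i < j <= n by lia.
have [|e1 e2] := polyline_meet (z := p i) ij' (segment_l _ _).
  by rewrite e; apply: segment_r.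
by apply: (neq (i := i)); rewrite ?e2 ?e1 //; lia.
Qed.

Lemma polyline_first i : i <= n -> segment (p i) (p i.+1) (p 0) -> i = 0.
Proof.
move=> ile h; case: (posnP i) => // ip.
have [|e1 e2] := polyline_meet (i := 0) (j := i) (z := p 0) _ (segment_l _ _) h; first lia.
by have := polyline_simple (i := 0) (j := i) _ _ e2; lia.
Qed.

Lemma polyline_last i : i <= n -> segment (p i) (p i.+1) (p n.+1) -> i = n.
Proof.
move=> ile h; case: (eqVneq i n) => // ne.
have [|e1 e2] := polyline_meet (i := i) (j := n) (z := p n.+1) _ h (segment_r _ _); first lia.
by have := polyline_simple (i := n.+1) (j := n) _ _ e2; lia.
Qed.

End PolygonalLine.

Lemma oriented_set_inj (G : sgraph) (e e' : G * G) : oriented G e -> oriented G e' ->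
  [set e.1; e.2] = [set e'.1; e'.2] -> e = e'.
Proof.
move=> /andP[_ lt] /andP[_ lt'] E.
have h1 : e.1 \in [set e'.1; e'.2] by rewrite -E !inE eqxx.
have h2 : e.2 \in [set e'.1; e'.2] by rewrite -E !inE eqxx orbT.
clear E; case: e e' => [x y] [x' y'] /= in lt lt' h1 h2 *.
move: h1 h2 lt lt'; rewrite !inE => /orP[] /eqP-> /orP[] /eqP-> //; rewrite ?ltnn //.
by move=> l1 l2; have := ltn_trans l1 l2; rewrite ltnn.
Qed.

Lemma planar_polydrawing (R : realType) (G : sgraph) : planar R G ->
  exists (pos : G -> R * R) n p, polydrawing pos n p.
Proof.
case=> pos [arc [pos_inj arcP arc_vertex arc_cross]].
have ex (e : G * G) : exists np : nat * (nat -> R * R), oriented G e ->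
    let: (n, p) := np in
    [/\ p 0 = pos e.1 /\ p n.+1 = pos e.2,
        forall i, i <= n -> p i <> p i.+1,
        forall i, i < n ->
          (segment (p i) (p i.+1) `&` segment (p i.+1) (p i.+2) = [set p i.+1])%classic,
        forall i j, i.+1 < j <= n ->
          (segment (p i) (p i.+1) `&` segment (p j) (p j.+1) = classical_sets.set0)%classic &
        arc [set e.1; e.2] =
          (\bigcup_(i in [set i | (i <= n)%N]) segment (p i) (p i.+1))%classic].
  case: (boolP (oriented G e)) => [/andP[ae _]|_]; last by exists (0, fun=> pos e.1).
  by have [n [p h]] := arcP _ _ ae; exists (n, p).
have {ex} [np npP] := choice ex.
pose n e := (np e).1; pose p e := (np e).2.
have {npP} H e : oriented G e -> [/\ p e 0 = pos e.1 /\ p e (n e).+1 = pos e.2,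
        forall i, i <= n e -> p e i <> p e i.+1,
        forall i, i < n e ->
          (segment (p e i) (p e i.+1) `&` segment (p e i.+1) (p e i.+2) = [set p e i.+1])%classic,
        forall i j, i.+1 < j <= n e ->
          (segment (p e i) (p e i.+1) `&` segment (p e j) (p e j.+1) = classical_sets.set0)%classic &
        arc [set e.1; e.2] =
          (\bigcup_(i in [set i | (i <= n e)%N]) segment (p e i) (p e i.+1))%classic].
  by move=> /npP; rewrite /n /p; case: (np e).
have arc_seg e i z : oriented G e -> i <= n e -> segment (p e i) (p e i.+1) z ->
    arc [set e.1; e.2] z.
  by move=> oe ie h; have [_ _ _ _ ->] := H e oe; exists i.
have arc_pt e i : oriented G e -> i <= (n e).+1 -> arc [set e.1; e.2] (p e i).
  move=> oe; case: i => [|i] ie.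
    by apply: (arc_seg _ 0) => //; apply: segment_l.
  by apply: (arc_seg _ i) => //; apply: segment_r.
have simple e i j : oriented G e -> i <= (n e).+1 -> j <= (n e).+1 ->
    p e i = p e j -> i = j.
  by move=> oe; have [_ h1 h2 h3 _] := H e oe; apply: polyline_simple.
have bend_int e i : oriented G e -> 0 < i <= n e ->
    (arc [set e.1; e.2]%SET `\` [set pos e.1; pos e.2])%classic (p e i).
  move=> oe ie; split; first by apply: arc_pt => //; lia.
  have [[<- <-] _ _ _ _] := H e oe.
  by case=> /simple h; [have := h oe|have := h oe]; lia.
have endpt e i z : oriented G e -> i <= n e -> segment (p e i) (p e i.+1) z ->
    ([set pos e.1; pos e.2])%classic z -> z = p e i \/ z = p e i.+1.
  move=> oe ie h; have [[<- <-] h1 h2 h3 _] := H e oe.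
  case=> e0; rewrite /= e0 in h *.
    by left; rewrite (polyline_first h1 h2 h3 ie h).
  by right; rewrite (polyline_last h1 h2 h3 ie h).
have cross_end e e' z : oriented G e -> oriented G e' -> e <> e' ->
    arc [set e.1; e.2] z -> arc [set e'.1; e'.2] z -> ([set pos e.1; pos e.2])%classic z.
  move=> oe oe' ne h h'; apply: contrapT => hn.
  have /andP[ae _] := oe; have /andP[ae' _] := oe'.
  have := arc_cross _ _ _ _ ae ae' (fun E => ne (oriented_set_inj oe oe' E)).
  by rewrite -classical_sets.subset0 => /(_ z); apply.
have ncseg e i e' i' z : oriented G e -> oriented G e' -> i <= n e -> i' <= n e' ->
    (e, i) <> (e', i') -> segment (p e i) (p e i.+1) z -> segment (p e' i') (p e' i'.+1) z ->
    (z = p e i \/ z = p e i.+1) /\ (z = p e' i' \/ z = p e' i'.+1).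
  move=> oe oe' ie ie' ne h h'; have [ee|nee] := pselect (e = e').
    subst e'; have [_ h1 h2 h3 _] := H e oe.
    have [lt|lt|eii] := ltngtP i i'; last by rewrite eii in ne.
      have [|-> ->] := polyline_meet h2 h3 (z := z) (i := i) (j := i') _ h h'; first lia.
      by auto.
    have [|-> ->] := polyline_meet h2 h3 (z := z) (i := i') (j := i) _ h' h; first lia.
    by auto.
  have az := arc_seg _ _ _ oe ie h; have az' := arc_seg _ _ _ oe' ie' h'.
  split; first exact/(endpt _ _ _ oe ie h)/(cross_end _ _ _ oe oe' nee az az').
  exact/(endpt _ _ _ oe' ie' h')/(cross_end _ _ _ oe' oe (nesym nee) az' az).
(* The corners of all arcs together, so that one shear serves the whole drawing. *)
pose pts := flatten [seq [seq p e i | i <- iota 0 (n e).+2] | e <- enum {: G * G}].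
have in_pts e i : i <= (n e).+1 -> p e i \in pts.
  move=> ie; apply/flattenP; exists [seq p e i | i <- iota 0 (n e).+2].
    by apply: map_f; rewrite mem_enum.
  by apply: map_f; rewrite mem_iota.
have [eps epsP] := exists_shear pts.
have sinj := @shear_inj _ eps.
have absneq e i : oriented G e -> i <= n e ->
    (shear eps (p e i)).1 != (shear eps (p e i.+1)).1.
  move=> oe ie; apply/eqP => /epsP h; have [_ h1 _ _ _] := H e oe; apply: (h1 _ ie).
  by apply: h; apply: in_pts => //; apply: leqW.
exists (shear eps \o pos), n, (fun e i => shear eps (p e i)); split => /=.
- by apply: inj_comp.
- by move=> e oe; have [[-> _]] := H e oe.
- by move=> e oe; have [[_ ->]] := H e oe.
- move=> e i z oe ie /sinj E; have [/= h1 h2] := bend_int _ _ oe ie.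
  have /andP[ae _] := oe; apply: (arc_vertex _ _ z ae); rewrite -E; split=> //.
- by move=> e i j oe ie je /sinj; apply: simple.
- move=> e i e' i' oe oe' ie ie' /sinj E; apply: contrapT => ne.
  have [h1 h2] := bend_int _ _ oe ie; apply: h2.
  by apply: (cross_end _ _ _ oe oe' ne) => //; rewrite E; apply: arc_pt.
- move=> e i e' i' oe oe' ie ie' /epsP h.
  by rewrite h // in_pts.
- move=> e i e' i' oe oe' ie ie' ne x b1 b2 E.
  have s1 := segment_line (absneq _ _ oe ie) b1.
  have s2 := segment_line (absneq _ _ oe' ie') b2; rewrite -E in s2.
  set y := line _ _ x in E s1 s2.
  have ez : (x, y) = shear eps ((x - eps * y)%R, y) by rewrite /shear /= subrK.
  rewrite ez in s1 s2.
  have [z1 z2] := ncseg _ _ _ _ _ oe oe' ie ie' ne (segment_shear s1) (segment_shear s2).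
  have xz : x = (shear eps ((x - eps * y)%R, y)).1 by rewrite /= subrK.
  by rewrite xz; split; [case: z1 => ->|case: z2 => ->]; auto.
Qed.

Lemma planar_rotation (R : realType) (G : sgraph) : planar R G ->
  exists s : G -> seq G, [/\ forall x, uniq (s x),
    forall x y, (y \in s x) = adj x y & separating s].
Proof.
move=> /planar_polydrawing [pos [n [p drawn]]].
exists (rotation pos n p); split.
- exact: rotation_uniq.
- exact: mem_rotation.
- exact: rotation_separating.
Qed.

(** * Discharging *)

Lemma index_prev (T : eqType) (s : seq T) (x : T) : uniq s -> x \in s ->
  index (prev s x) s = if index x s is i.+1 then i else (size s).-1.
Proof.
move=> su xs; rewrite prev_nth xs; case: s su xs => // h q hq xs.
have [<-|hx] := eqVneq h x.
  have -> : index h (h :: q) = 0 by rewrite /= eqxx.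
  have -> : index h q = size q by apply: memNindex; case/andP: hq.
  by rewrite index_uniq.
have -> : index x (h :: q) = (index x q).+1 by rewrite /= (negPf hx).
by rewrite index_uniq // /= ltnS index_size.
Qed.

Lemma sumz_const (I : finType) (A : {pred I}) (c : int) :
  (\sum_(i in A) c = c * #|A|%:Z)%R.
Proof. by rewrite sumr_const -mulr_natr natz. Qed.

Definition deg (G : sgraph) (x : G) := #|[pred y | adj x y]|.

Section Discharging.
Variables (G : sgraph) (s : G -> seq G).
Hypothesis s_uniq : forall x, uniq (s x).
Hypothesis mem_s : forall x y, (y \in s x) = adj x y.
Hypothesis no3 : forall x y z : G, adj x y -> adj y z -> adj z x -> False.
Hypothesis no4 : forall x y z w : G,
  adj x y -> adj y z -> adj z w -> adj w x -> x != z -> y != w -> False.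
Hypothesis no6 : forall x0 x1 x2 x3 x4 x5 : G, uniq [:: x0; x1; x2; x3; x4; x5] ->
  adj x0 x1 -> adj x1 x2 -> adj x2 x3 -> adj x3 x4 -> adj x4 x5 -> adj x5 x0 -> False.
Hypothesis deg_ge2 : forall x : G, 2 <= deg x.

Definition high (x : G) := 42 <= deg x.
Definition nhigh (x : G) := #|[pred y | adj x y && high y]|.
Hypothesis low_high : forall x : G, ~~ high x -> 0 < nhigh x.

Local Notation phi := (face_next mem_s).
Local Notation dart := (dart G).

Lemma size_s x : size (s x) = deg x.
Proof. by rewrite -(card_uniqP (s_uniq x)); apply: eq_card => y; rewrite mem_s inE. Qed.

Lemma prev_neq x y : adj x y -> prev (s x) y != y.
Proof.
move=> axy; apply/eqP => e; have := index_prev (s_uniq x) (x := y); rewrite mem_s e => /(_ axy).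
by have := deg_ge2 x; rewrite -size_s; case: (index y _) => [|i]; case: (size _) => [|[|n]] //= _; lia.
Qed.

Lemma prev_swap x y z : adj x y -> prev (s x) y = z -> prev (s x) z = y -> deg x = 2.
Proof.
move=> axy e1 e2; have := index_prev (s_uniq x) (x := y); rewrite mem_s e1 => /(_ axy).
have := index_prev (s_uniq x) (x := z).
have axz : adj x z by rewrite -mem_s -e1 mem_prev mem_s.
have : index z (s x) < size (s x) by rewrite index_mem mem_s.
have : index y (s x) < size (s x) by rewrite index_mem mem_s.
rewrite mem_s e2 => h1 h2 /(_ axz); have := deg_ge2 x; rewrite -size_s.
by move: h1 h2; case: (index y _) => [|i]; case: (index z _) => [|j]; move: (size _) => n; lia.
Qed.

(** * Lengths of face walks *)

Section Walk.
Variable d : dart.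
Definition fv i := (val (iter i phi d)).1.

Lemma fv_adj i : adj (fv i) (fv i.+1).
Proof. exact: (valP (iter i phi d)). Qed.

Lemma fv_prev i : fv i.+2 = prev (s (fv i.+1)) (fv i).
Proof. by []. Qed.

Lemma fv_neq2 i : fv i != fv i.+2.
Proof. by rewrite fv_prev eq_sym; apply: prev_neq; rewrite adj_sym fv_adj. Qed.

Lemma fv_neq1 i : fv i != fv i.+1.
Proof. by apply: contraTneq (fv_adj i) => ->; rewrite adj_irrefl. Qed.

Lemma fv_neq3 i : fv i != fv i.+3.
Proof.
apply/eqP => e; apply: (no3 (fv_adj i) (fv_adj i.+1)); rewrite e; exact: fv_adj.
Qed.

Lemma fv_order i : fv (i + order phi d) = fv i.
Proof. by rewrite /fv iterD iter_order //; apply: face_next_inj. Qed.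

Lemma fv_order5 : order phi d = 5 -> uniq [:: fv 0; fv 1; fv 2; fv 3; fv 4].
Proof.
move=> o5; have e0 := fv_order 0; have e1 := fv_order 1; rewrite o5 in e0 e1.
have n3 : fv 0 != fv 3 by exact: fv_neq3.
have n4 : fv 4 != fv 0 by rewrite -e0; apply: fv_neq1.
have n5 : fv 4 != fv 1 by rewrite -e1; apply: fv_neq2.
by rewrite /= !inE !negb_or !fv_neq1 !fv_neq2 n3 [fv 0 == fv 4]eq_sym n4 [fv 1 == _]eq_sym n5.
Qed.

(** Minimum degree 2 keeps a face walk from turning back, and without triangles its vertices three
    steps apart differ. So a face walk of length 3, 4 or 6 would be a cycle. *)
Lemma face_length : order phi d = 5 \/ 7 <= order phi d.
Proof.
have op : 0 < order phi d by exact: order_gt0.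
have e := fv_order 0; have e1 := fv_order 1.
case: (ltnP 6 (order phi d)) => [|o6]; first by right.
left; case: (order phi d) op o6 e e1 => // -[|[|[|[|[|[|//]]]]]] //= _ _ e e1; exfalso.
- by have := fv_neq1 0; rewrite e eqxx.
- by have := fv_neq2 0; rewrite e eqxx.
- by have := fv_neq3 0; rewrite e eqxx.
- apply: (no4 (fv_adj 0) (fv_adj 1) (fv_adj 2)); rewrite ?fv_neq2 //.
  by rewrite -e fv_adj.
- apply: (no6 (x0 := fv 0) (x1 := fv 1) (x2 := fv 2) (x3 := fv 3) (x4 := fv 4) (x5 := fv 5));
    rewrite ?fv_adj //; last by rewrite -[X in adj _ X]e fv_adj.
  rewrite /= !inE !negb_or !fv_neq1 !fv_neq2 !fv_neq3.
  have -> : (fv 0 == fv 4) = false by apply: contraNF (fv_neq2 4) => /eqP <-; rewrite -e.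
  have -> : (fv 0 == fv 5) = false by apply: contraNF (fv_neq1 5) => /eqP <-; rewrite -e.
  by have -> : (fv 1 == fv 5) = false by apply: contraNF (fv_neq2 5) => /eqP <-; rewrite -e1.
Qed.

End Walk.

Lemma deg2_nbr (x a b y : G) : deg x = 2 -> adj x a -> adj x b -> a != b -> adj x y ->
  y = a \/ y = b.
Proof.
move=> d2 xa xb nab ay; case: (eqVneq y a) => [|n1]; [by left|right].
case: (eqVneq y b) => // n2; exfalso.
have : #|[set a; b; y]| <= deg x.
  by apply/subset_leq_card/subsetP => z; rewrite !inE => /orP[/orP[]|] /eqP->.
by rewrite -setUA cardsU1 cards2 !inE negb_or nab eq_sym n1 eq_sym n2 d2.
Qed.

Lemma card_darts_at x (P : pred G) :
  #|[pred d : dart | ((val d).1 == x) && P (val d).2]| = #|[pred y | adj x y && P y]|.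
Proof.
rewrite -(card_in_imset (f := fun d : dart => (val d).2)); last first.
  move=> [[a b] h] [[a' b'] h'] /=; rewrite !inE /= => /andP[/eqP ea _] /andP[/eqP ea' _] eb.
  by apply: val_inj; rewrite /= eb ea ea'.
apply: eq_card => y; rewrite [RHS]inE /=; apply/imsetP/andP.
  by case=> d; rewrite inE => /andP[/eqP <- Pd] ->; split=> //; apply: (valP d).
case=> axy Py; exists (exist (fun d : G * G => adj d.1 d.2) (x, y) axy) => //.
by rewrite inE /= eqxx.
Qed.

(** Without [x], the pentagons x a c e b and x b c' e' a leave the closed walk a c e b c' e'. This
    is a C_6, unless c = e' or e = c'. If just one of these holds, a C_4 appears; if both hold, the
    rotations at [a] and [b] show that these have degree 2, so the low vertex [x] has no high
    neighbour. *)
Lemma face5_unique (d d' : dart) : (val d).1 = (val d').1 -> d <> d' ->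
  deg (val d).1 = 2 -> order phi d = 5 -> order phi d' = 5 -> False.
Proof.
move=> e01 ne d2 o5 o5'.
have h i := fv_order d i; rewrite o5 in h.
have h' i := fv_order d' i; rewrite o5' in h'.
have ex : fv d' 0 = fv d 0 by rewrite /fv /= e01.
have nab : fv d 1 != fv d' 1.
  apply/eqP => e; apply: ne; apply: val_inj.
  by rewrite [LHS]surjective_pairing [RHS]surjective_pairing e01; congr (_, _).
have Nx y : adj (fv d 0) y -> y = fv d 1 \/ y = fv d' 1.
  by apply: deg2_nbr => //; [exact: fv_adj | rewrite -ex; exact: fv_adj].
have x4 : fv d 4 = fv d' 1.
  have a : adj (fv d 0) (fv d 4) by rewrite adj_sym -(h 0); apply: fv_adj.
  case: (Nx _ a) => // e; have := fv_neq2 d 4; rewrite (h 1) e eqxx //.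
have x4' : fv d' 4 = fv d 1.
  have a : adj (fv d 0) (fv d' 4) by rewrite adj_sym -ex -(h' 0); apply: fv_adj.
  case: (Nx _ a) => // e; have := fv_neq2 d' 4; rewrite (h' 1) e eqxx //.
have u := fv_order5 o5; have u' := fv_order5 o5'.
set x := fv d 0 in ex Nx u *; set a := fv d 1 in nab Nx x4' u *.
set c := fv d 2 in u *; set e := fv d 3 in u *.
set b := fv d' 1 in nab Nx x4 u' *; set c' := fv d' 2 in u' *; set e' := fv d' 3 in u' *.
have aac : adj a c by exact: fv_adj.
have ace : adj c e by exact: fv_adj.
have aeb : adj e b by rewrite -x4; apply: fv_adj.
have abc : adj b c' by exact: fv_adj.
have ace' : adj c' e' by exact: fv_adj.
have aea : adj e' a by rewrite -x4'; apply: fv_adj.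
rewrite x4 in u; rewrite ex x4' in u'.
move: u u'; rewrite /= !inE !negb_or => /and5P[_ /and3P[ac ae ab] /andP[ce cb] eb _].
move=> /and5P[_ /and3P[bc' be' _] /andP[ce' ca'] ea' _].
have cc' : c != c' by apply/eqP => E; apply: (no3 (x := c) (y := e) (z := b)); rewrite // E.
have ee' : e != e' by apply/eqP => E; apply: (no3 (x := a) (y := c) (z := e)); rewrite // E.
have [E1|n1] := eqVneq c e'; have [E2|n2] := eqVneq e c'.
- have da : deg a = 2.
    apply: (@prev_swap a x c); first by rewrite adj_sym; apply: fv_adj.
      by rewrite -(fv_prev d 0).
    by have := fv_prev d' 3; rewrite x4' -/e' -E1 => <-; rewrite -ex; apply: (h' 0).
  have db : deg b = 2.
    apply: (@prev_swap b x e); first by rewrite adj_sym -ex; apply: fv_adj.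
      by rewrite E2 -ex -(fv_prev d' 0).
    by have := fv_prev d 3; rewrite x4 -/e => <-; apply: (h 0).
  have := low_high (x := x); rewrite /high [deg x]d2 => /(_ isT)/card_gt0P[y].
  by rewrite inE => /andP[/Nx[]->]; rewrite /high ?da ?db.
- by apply: (no4 (x := c) (y := e) (z := b) (w := c')); rewrite // E1.
- by apply: (no4 (x := a) (y := c) (z := e) (w := e')); rewrite // E2.
apply: (no6 (x0 := a) (x1 := c) (x2 := e) (x3 := b) (x4 := c') (x5 := e')) => //.
rewrite /= !inE !negb_or ac ae ab [a == c']eq_sym ca' [a == e']eq_sym ea' ce cb cc' n1.
by rewrite eb n2 ee' bc' be' ce'.
Qed.

Local Open Scope ring_scope.

(* Vertices start with charge 28 deg - 84 and faces with 14 length - 84, so that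
   the total is 84 (E - V - F). A vertex of degree at least 42 can give 26 along
   each incident edge: to the other end if it is low ([transfer]), and otherwise
   to a face at this edge. [weight d] is what the first vertex of [d] gives to the
   face of [d]. *)
Definition weight (d : dart) : int :=
  let x := (val d).1 in let y := (val d).2 in
  if high x then (if high y then 26 else 0)
  else if deg x == 2 then
    if nhigh x == 1%N then (if order phi d == 5 then 0 else - 2)
    else (if order phi d == 5 then 14 else 0)
  else if nhigh x == 1%N then 7 else 14.

Definition transfer (x : G) : int :=
  if high x then - (26 * #|[pred y | adj x y && ~~ high y]|%:Z) else 26 * (nhigh x)%:Z.

(** A high vertex gives 26 deg <= 28 deg - 84. At degree 2, one high neighbour leaves -28 + 26 = -2,
    recovered from a face that is not a pentagon; two leave 24, and only one face asks for 14. From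
    degree 3 on, 28 deg - 58 >= 7 deg and 28 deg - 32 >= 14 deg. *)
Lemma vertex_charge x : \sum_(d : dart | (val d).1 == x) weight d <=
  28 * (deg x)%:Z - 84 + transfer x.
Proof.
have cards : #|[pred d : dart | (val d).1 == x]| = deg x.
  rewrite -(eq_card (A := [pred d : dart | ((val d).1 == x) && predT (val d).2])) ?card_darts_at.
    by apply: eq_card => y; rewrite !inE andbT.
  by move=> d; rewrite !inE andbT.
have sumc (c : int) : \sum_(d : dart | (val d).1 == x) c = c * (deg x)%:Z.
  by rewrite sumz_const cards.
have sump (P : pred dart) (c : int) :
    \sum_(d : dart | (val d).1 == x) (if P d then c else 0) =
    c * #|[pred d : dart | ((val d).1 == x) && P d]|%:Z.
  by rewrite -big_mkcondr sumz_const.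
rewrite /transfer; case: (boolP (high x)) => [hx|lx].
  rewrite (eq_bigr (fun d : dart => if high (val d).2 then 26 else 0)).
    rewrite (sump (fun d => high (val d).2)) (card_darts_at x high).
    have : deg x = (#|[pred y | adj x y && high y]| + #|[pred y | adj x y && ~~ high y]|)%N.
      by rewrite /deg -(cardID high); congr addn; apply: eq_card => y; rewrite !inE andbC.
    move: hx; rewrite /high; lia.
  by move=> d /eqP xE; rewrite /weight xE hx.
have np := low_high lx.
have nle : (nhigh x <= deg x)%N.
  by apply: subset_leq_card; apply/subsetP => y; rewrite !inE => /andP[].
have [d2|d2] := eqVneq (deg x) 2%N; last first.
  rewrite (eq_bigr (fun=> if nhigh x == 1%N then 7 else 14)).
    have := deg_ge2 x; case: eqP => n1; rewrite sumc; lia.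
  by move=> d /eqP xE; rewrite /weight xE (negPf lx) (negPf d2).
pose B := [pred d : dart | ((val d).1 == x) && (order phi d == 5)].
have B1 : (#|B| <= 1)%N.
  rewrite leqNgt; apply/negP => /card_gt1P [d [d' []]].
  rewrite !inE => /andP[/eqP e1 /eqP o1] /andP[/eqP e2 /eqP o2] /eqP ne.
  by apply: (face5_unique (d := d) (d' := d')); rewrite ?e1 ?e2.
have [n1|n1] := eqVneq (nhigh x) 1%N.
  rewrite (eq_bigr (fun d => - 2 + (if order phi d == 5 then 2 else 0))).
    rewrite big_split /= sumc (sump (fun d => order phi d == 5)) -/B; lia.
  move=> d /eqP xE; rewrite /weight xE (negPf lx) d2 n1 /=.
  by case: ifP.
rewrite (eq_bigr (fun d => if order phi d == 5 then 14 else 0)).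
  rewrite (sump (fun d => order phi d == 5)) -/B; lia.
by move=> d /eqP xE; rewrite /weight xE (negPf lx) d2 (negPf n1).
Qed.

Lemma transfer_sum : \sum_x transfer x = 0.
Proof.
have e x : transfer x = 26 * (\sum_(y | adj x y) ((~~ high x && high y)%:Z - (high x && ~~ high y)%:Z)).
  rewrite /transfer /nhigh; case: (high x) => /=.
    rewrite sumrB big1 // sub0r mulrN; congr (- (26 * _)).
    by rewrite -natz -sum1_card natr_sum big_mkcondr /=; apply: eq_bigr => y _; case: high.
  rewrite sumrB [X in _ - X]big1 // subr0; congr (26 * _).
  by rewrite -natz -sum1_card natr_sum big_mkcondr /=; apply: eq_bigr => y _; case: high.
rewrite (eq_bigr _ (fun x _ => e x)) -mulr_sumr.
under eq_bigr do rewrite sumrB.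
rewrite sumrB [X in _ - X](exchange_big_dep xpredT) //=.
rewrite [X in _ * X](_ : _ = 0) ?mulr0 //; apply/eqP; rewrite subr_eq0; apply/eqP.
apply: eq_bigr => x _; rewrite [RHS](eq_bigl (adj x)) => [|y]; last exact: adj_sym.
by apply: eq_bigr => y _; rewrite andbC.
Qed.

Lemma order_phi d : order phi (phi d) = order phi d.
Proof.
apply: eq_card => d'; rewrite !inE; apply/esym/same_fconnect1.
exact: face_next_inj.
Qed.

Lemma order_iter_phi i d : order phi (iter i phi d) = order phi d.
Proof. by elim: i => //= i; rewrite order_phi. Qed.

(* A lower bound for the weight that a vertex on a pentagon contributes, given
   whether it is high, whether it has degree 2, and whether its two neighbours
   on the pentagon are high. *)
Definition weight_bound (h t hu hy : bool) : nat :=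
  if h then (if hy then 26 else 0)
  else if hu && hy then 14 else if t then 0 else 7.

Lemma weight_boundP (d : dart) u : order phi d = 5 -> adj (val d).1 u -> u != (val d).2 ->
  (weight_bound (high (val d).1) (deg (val d).1 == 2) (high u) (high (val d).2))%:Z
    <= weight d.
Proof.
move=> o5 au uy; rewrite /weight o5 eqxx /weight_bound; case: (high (val d).1) => /=.
  by case: high.
have ad : adj (val d).1 (val d).2 by exact: (valP d).
have two : high u && high (val d).2 -> nhigh (val d).1 != 1%N.
  move=> /andP[hu hy]; have : (#|[set u; (val d).2]| <= nhigh (val d).1)%N.
    by apply/subset_leq_card/subsetP => z; rewrite !inE => /orP[] /eqP->; rewrite ?au ?ad.
  by rewrite cards2 uy; case: nhigh => // -[].
case: ifP => [/two/negPf->|_]; first by case: ifP.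
by case: (deg _ == _); case: (nhigh _ == _).
Qed.

(** A low vertex of degree 2 has only the two neighbours along the face, so its high neighbour is
    one of them. *)
Lemma pentagon_high (d : dart) u : adj (val d).1 u -> u != (val d).2 ->
  [|| high (val d).1, deg (val d).1 != 2%N, high u | high (val d).2].
Proof.
move=> au uy; apply/or4P; case: (boolP (high (val d).1)) => [|lx]; first by constructor 1.
case: eqP => [d2|]; last by constructor 2.
have /card_gt0P[y] := low_high lx; rewrite inE => /andP[ay hy].
have [e|e] := deg2_nbr d2 au (valP d) uy ay; rewrite e in hy.
  by constructor 3.
by constructor 4.
Qed.

Lemma face_charge d :
  0 <= 14 * (order phi d)%:Z - 84 + \sum_(d' <- orbit phi d) weight d'.
Proof.
case: (face_length d) => [o5|o7].
  have h i := fv_order d i; rewrite o5 in h.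
  have E i : weight (iter i.+1 phi d) >= (weight_bound (high (fv d i.+1))
      (deg (fv d i.+1) == 2) (high (fv d i)) (high (fv d i.+2)))%:Z.
    apply: weight_boundP; first by rewrite order_iter_phi.
      by rewrite adj_sym; apply: fv_adj.
    exact: fv_neq2.
  have P i : [|| high (fv d i.+1), deg (fv d i.+1) != 2%N, high (fv d i) | high (fv d i.+2)].
    by apply: (@pentagon_high (iter i.+1 phi d)); [rewrite adj_sym; apply: fv_adj|apply: fv_neq2].
  have i5 : iter 5 phi d = d by rewrite -o5 iter_order //; apply: face_next_inj.
  have := E 4; rewrite i5.
  move: (E 0) (E 1) (E 2) (E 3) (P 0) (P 1) (P 2) (P 3) (P 4).
  rewrite /orbit o5 /= !big_cons big_nil.
  have -> : fv d 5 = fv d 0 by exact: (h 0).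
  have -> : fv d 6 = fv d 1 by exact: (h 1).
  set w0 := weight d; set w1 := weight _; set w2 := weight _; set w3 := weight _.
  set w4 := weight _.
  move: w0 w1 w2 w3 w4 => w0 w1 w2 w3 w4.
  move: (high (fv d 0)) (high (fv d 1)) (high (fv d 2)) (high (fv d 3)) (high (fv d 4)).
  move: (deg (fv d 0) == _) (deg (fv d 1) == _) (deg (fv d 2) == _) (deg (fv d 3) == _)
    (deg (fv d 4) == _).
  move=> t0 t1 t2 t3 t4 h0 h1 h2 h3 h4 e1 e2 e3 e4 p1 p2 p3 p4 p0 e0.
  (* A pentagon lacks 14. Two adjacent high vertices give 26, and two high vertices that are not
     adjacent have a common low neighbour giving 14. With one high vertex, the two vertices away
     from it have degree at least 3 and give 7 each; with none, all five do. *)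
  have : (14 <= weight_bound h1 t1 h0 h2 + weight_bound h2 t2 h1 h3 +
     weight_bound h3 t3 h2 h4 + weight_bound h4 t4 h3 h0 + weight_bound h0 t0 h4 h1)%N.
    clear - p0 p1 p2 p3 p4; move: p0 p1 p2 p3 p4.
    by case: h0; case: h1; case: h2; case: h3; case: h4; case: t0; case: t1; case: t2;
      case: t3; case: t4.
  lia.
(* A longer face may lose 2 at each corner: 14 l - 84 - 2 l is nonnegative from l = 7 on. *)
have -> : \sum_(d' <- orbit phi d) weight d' =
    \sum_(d' <- orbit phi d) (weight d' + 2) - 2 * (order phi d)%:Z.
  rewrite big_split /= big_const_seq count_predT size_orbit iter_addr addr0.
  by rewrite -[2 *+ order phi d]mulr_natr (natz (order phi d)) addrK.
have : 0 <= \sum_(d' <- orbit phi d) (weight d' + 2).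
  apply: sumr_ge0 => d' _; rewrite /weight.
  by do ![case: ifP => _].
lia.
Qed.

Lemma discharging_contradiction (x0 : G) : separating s -> False.
Proof.
move=> /(euler_ineq s_uniq mem_s)/(_ x0) euler.
have csym : connect_sym (frel phi) by apply: fconnect_sym; apply: face_next_inj.
have orbE r : r \in froots phi -> [pred d | froot phi d == r] =i orbit phi r.
  move=> /eqP rr d; rewrite inE -fconnect_orbit -{1}rr eq_sym.
  by rewrite root_connect.
have faces (F : dart -> int) : \sum_d F d =
    \sum_(r | r \in froots phi) \sum_(d <- orbit phi r) F d.
  rewrite (partition_big (froot phi) (fun r => r \in froots phi)) /=; last first.
    by move=> d _; apply: roots_root.
  apply: eq_bigr => r rr; rewrite big_uniq ?orbit_uniq //.
  by apply: eq_bigl => d; rewrite -orbE // inE.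
have vertices (F : dart -> int) : \sum_d F d = \sum_x \sum_(d : dart | (val d).1 == x) F d.
  by rewrite (partition_big (fun d : dart => (val d).1) xpredT).
have darts_deg : \sum_(x : G) (deg x)%:Z = #|{: dart}|%:Z.
  rewrite card_dart -card_oriented -[RHS]natz natr_sum.
  by apply: eq_bigr => x _; rewrite natz.
have darts_ord : \sum_(r | r \in froots phi) (order phi r)%:Z = #|{: dart}|%:Z.
  have := faces (fun=> 1); rewrite sumr_const natz => ->.
  apply: eq_bigr => r _.
  by rewrite big_const_seq count_predT size_orbit iter_addr addr0 natz.
have V : \sum_d weight d <= 28 * #|{: dart}|%:Z - 84 * #|G|%:Z.
  rewrite vertices -darts_deg mulr_sumr.
  have -> : 84 * #|G|%:Z = \sum_(x : G) 84 by rewrite sumz_const.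
  apply: le_trans (ler_sum _ (fun x _ => vertex_charge x)) _.
  by rewrite big_split /= transfer_sum addr0 sumrB.
have F : 0 <= 14 * #|{: dart}|%:Z - 84 * (fcard phi {: dart})%:Z + \sum_d weight d.
  rewrite faces -darts_ord mulr_sumr.
  have -> : 84 * (fcard phi {: dart})%:Z = \sum_(r | r \in froots phi) 84.
    rewrite sumz_const; congr (84 * _%:Z).
    by apply: eq_card => d; rewrite !inE andbT.
  rewrite -sumrB -big_split /=; apply: sumr_ge0 => r _; apply: face_charge.
(* Together the bounds give 84 (V + F) <= 42 darts, whereas Euler's inequality reads darts + 2 <= 2
   (V + F). *)
lia.
Qed.

End Discharging.

(** * Planar graphs without cycles of length 3, 4, 6 *)

Definition coloring (G : sgraph) (D : nat) (I : pred G) : Prop :=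
  (forall x y, adj x y -> I x -> I y -> False) /\
  (forall x, ~~ I x -> #|[pred y | adj x y && ~~ I y]| <= D).

Lemma colorableP (G : sgraph) D :
  colorable [tuple 0; D] G <-> exists I : pred G, coloring D I.
Proof.
split=> [[c cP]|[I [I0 ID]]].
  exists (fun x => c x == ord0); split=> [x y axy /eqP cx /eqP cy|x cx].
    have := cP ord0 x cx; rewrite (tnth_nth 0) /= leqn0 => /eqP/card0_eq/(_ y).
    by rewrite !inE axy cy eqxx.
  have E (z : G) : (c z != ord0) = (c z == ord_max).
    by case: (c z) => -[|[|//]] h; rewrite -!val_eqE.
  have /eqP := cx; rewrite -/(_ == _) => _; move: cx; rewrite E => /eqP cx.
  have := cP ord_max x cx; rewrite (tnth_nth 0) /= => h.
  by apply: leq_trans h; apply: eq_leq; apply: eq_card => y; rewrite !inE E.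
exists (fun x => if I x then ord0 else ord_max) => i v; case: ifP => Iv <-.
  rewrite (tnth_nth 0) /= leqn0; apply/eqP/eq_card0 => y; rewrite !inE.
  by apply/negP => /andP[avy]; case: ifP => // Iy; case: (I0 _ _ avy Iv Iy).
rewrite (tnth_nth 0) /=; apply: leq_trans (ID v (negbT Iv)); apply: subset_leq_card.
by apply/subsetP => y; rewrite !inE => /andP[->]; case: (I y).
Qed.

(** * Deleting a vertex and extending a colouring *)

Section Delete.
Variables (G : sgraph) (v : G).

Definition del_adj : rel {x : G | x != v} := fun x y => adj (val x) (val y).
Lemma del_adj_sym : symmetric del_adj. Proof. by move=> x y; apply: adj_sym. Qed.
Lemma del_adj_irrefl : irreflexive del_adj. Proof. by move=> x; apply: adj_irrefl. Qed.
Definition del : sgraph := SGraph del_adj_sym del_adj_irrefl.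

Lemma card_del : #|del| < #|G|.
Proof.
rewrite /= card_sig; have -> : #|[pred x | x != v]| = #|G|.-1 by rewrite -(cardC1 v).
rewrite ltn_predL.
by apply/card_gt0P; exists v.
Qed.

Lemma del_subgraph (H : sgraph) : has_subgraph del H -> has_subgraph G H.
Proof.
case=> f finj fadj; exists (fun x => val (f x)); last exact: fadj.
by move=> x y /val_inj/finj.
Qed.

Lemma del_planar (R : realType) : planar R G -> planar R del.
Proof.
case=> pos [arc [h1 h2 h3 h4]].
pose f (z : del) : G := val z; have finj : injective f by exact: val_inj.
have im (x y : del) : f @: [set x; y] = [set f x; f y].
  by rewrite imsetU1 imset_set1.
exists (fun x => pos (f x)), (fun e : {set del} => arc (f @: e)); split.
- by move=> x y /h1/finj.
- by move=> x y axy; rewrite im; apply: h2.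
- by move=> x y z axy; rewrite im; apply: h3.
- move=> x y x' y' a a' ne; rewrite !im; apply: h4 => // E; apply: ne.
  by apply: (imset_inj finj); rewrite !im.
Qed.

Lemma del_coloring D (I : pred del) : coloring D I ->
  exists J : pred G, (forall x y, x != v -> y != v -> adj x y -> J x -> J y -> False) /\
  (forall x, x != v -> ~~ J x -> #|[pred y | [&& adj x y, y != v & ~~ J y]]| <= D).
Proof.
case=> I0 ID; pose J x := if insub x is Some y then I y else false.
have JE x (h : x != v) : J x = I (Sub x h) by rewrite /J insubT.
exists J; split=> [x y xv yv a|x xv]; rewrite !JE.
  exact: I0.
move=> /ID; apply: leq_trans.
rewrite -(card_imset _ (@val_inj _ _ del)); apply/subset_leq_card/subsetP => y.
rewrite inE => /and3P[a yv Jy]; apply/imsetP; exists (Sub y yv) => //.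
by rewrite !inE -JE Jy andbT.
Qed.

End Delete.

Section Extend.
Variables (G : sgraph) (D : nat) (v : G) (I : pred G).
Hypothesis no3 : forall x y z : G, adj x y -> adj y z -> adj z x -> False.
Hypothesis I0 : forall x y, x != v -> y != v -> adj x y -> I x -> I y -> False.
Hypothesis ID : forall x, x != v -> ~~ I x ->
  #|[pred y | [&& adj x y, y != v & ~~ I y]]| <= D.

Lemma extend_indep : (forall w, adj v w -> ~~ I w) -> exists J : pred G, coloring D J.
Proof.
move=> nI; exists (fun x => (x == v) || I x); split=> [x y|x].
  case: (eqVneq x v) => [->|xv]; case: (eqVneq y v) => [->|yv] //=.
  - by rewrite adj_irrefl.
  - by move=> /nI/negPf->.
  - by rewrite adj_sym => /nI/negPf->.
  - exact: I0.
rewrite negb_or => /andP[xv Ix]; apply: leq_trans (ID xv Ix).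
by apply/subset_leq_card/subsetP => y; rewrite !inE negb_or.
Qed.

(* If v has a neighbour in I, put v in the complement, and move to I the
   neighbours of v that become overfull. *)
Lemma extend_low w0 : adj v w0 -> I w0 -> deg v <= D.+1 ->
  (forall w, adj v w -> ~~ I w -> deg w <= D.+1) -> exists J : pred G, coloring D J.
Proof.
move=> avw0 Iw0 dv dw.
pose nb x := #|[pred y | [&& adj x y, y != v & ~~ I y]]|.
pose bad w := [&& adj v w, ~~ I w & D <= nb w].
have nev x : adj v x -> x != v by apply: contraTneq => ->; rewrite adj_irrefl.
(* The vertex [v] and [D] neighbours outside [I] already exhaust the degree of [x]. *)
have bad_nbr x y : bad x -> adj x y -> y != v -> ~~ I y.
  move=> /and3P[avx Ix Dx] axy yv; apply/negP => Iy.
  have : #|v |: (y |: [set z | [&& adj x z, z != v & ~~ I z]])| <= deg x.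
    apply/subset_leq_card/subsetP => z; rewrite !inE.
    by case/or3P=> [/eqP->|/eqP->//|/and3P[]//]; rewrite adj_sym.
  rewrite !cardsU1 !inE eqxx Iy andbF (eq_sym v) yv /= cardsE -/(nb x).
  have := dw _ avx Ix; move: Dx; rewrite !andbF /=; move: (deg x) (nb x) => a b; lia.
exists (fun x => (x != v) && (I x || bad x)); split=> [x y axy|x].
  case/andP=> xv Jx /andP[yv Jy].
  (* Moved vertices are neighbours of [v], so two adjacent ones would give a triangle. *)
  case: (boolP (bad x)) Jx => [bx _|_].
    rewrite (negPf (bad_nbr _ _ bx axy yv)) /= in Jy.
    have /and3P[avx _ _] := bx; have /and3P[avy _ _] := Jy.
    by apply: (no3 avx axy); rewrite adj_sym.
  rewrite orbF => Ix; case: (boolP (bad y)) Jy => [by_ _|_].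
    by have := bad_nbr _ _ by_ (_ : adj y x) xv; rewrite Ix adj_sym => /(_ axy).
  by rewrite orbF; apply: I0 Ix.
case: (eqVneq x v) => [-> _|xv /=].
  rewrite -ltnS; apply: leq_trans dv.
  apply: (@leq_trans #|[pred y | adj v y] |); last by [].
  rewrite [X in _ <= X](cardD1 w0) inE avw0 add1n ltnS.
  apply/subset_leq_card/subsetP => y; rewrite !inE negb_and negb_or negbK => /andP[avy].
  by rewrite avy (negPf (nev _ avy)) /= andbT; apply: contraTneq => ->; rewrite Iw0.
rewrite negb_or => /andP[Ix nbx].
have h := ID xv Ix.
case: (boolP (adj v x)) => [avx|navx].
  have nbD : nb x < D by move: nbx; rewrite /bad avx Ix /= -ltnNge.
  apply: leq_trans nbD; rewrite /nb -cardsE -(cardsE [pred y | [&& adj x y, y != v & ~~ I y]]).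
  apply: (@leq_trans #|v |: [set y | [&& adj x y, y != v & ~~ I y]]|).
    apply/subset_leq_card/subsetP => y; rewrite !inE negb_and negb_or negbK.
    by case: eqP => //= _ /and3P[-> ->].
  by rewrite cardsU1 !inE eqxx andbF /= add1n cardsE.
apply: leq_trans h; apply/subset_leq_card/subsetP => y.
rewrite !inE negb_and negb_or negbK; case: eqP => [->|_] //=.
  by rewrite adj_sym (negPf navx).
by case/and3P=> -> ->.
Qed.

End Extend.

Lemma cycle_has_subgraph (G : sgraph) (p : seq G) : uniq p -> cycle adj p ->
  has_subgraph G (cycle_graph (size p)).
Proof.
move=> pu pc; case: p => [|x0 p'] in pu pc *.
  by exists (fun i : 'I_0 => match (ltn_ord i : false) with end) => -[].
set p := x0 :: p' in pu pc *.
exists (fun i : 'I_(size p) => nth x0 p i) => [i j /eqP|i j].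
  by rewrite nth_uniq // => /eqP/val_inj.
have step (i' j' : 'I_(size p)) : ordS i' == j' -> adj (nth x0 p i') (nth x0 p j').
  move=> /eqP<-; have := next_cycle pc (mem_nth x0 (ltn_ord i')).
  rewrite next_nth mem_nth // index_uniq // /p /=.
  case: (ltnP i' (size p')) => h; first by rewrite modn_small.
  have -> : i' = size p' :> nat by apply/eqP; rewrite eqn_leq h -ltnS (ltn_ord i').
  by rewrite modnn [nth x0 p' _]nth_default.
case/andP=> _ /orP[]; first exact: step.
by move/step; rewrite adj_sym.
Qed.

Section NoCycles.
Variable G : sgraph.

Lemma noC3 : ~ has_subgraph G (cycle_graph 3) ->
  forall x y z : G, adj x y -> adj y z -> adj z x -> False.
Proof.
move=> n3 x y z a1 a2 a3; apply: n3; apply: (@cycle_has_subgraph _ [:: x; y; z]).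
  have ne (u w : G) : adj u w -> u != w by apply: contraTneq => ->; rewrite adj_irrefl.
  by rewrite /= !inE negb_or (ne _ _ a1) (ne _ _ a2) eq_sym (ne _ _ a3).
by rewrite /= a1 a2 a3.
Qed.

Lemma noC4 : ~ has_subgraph G (cycle_graph 4) -> forall x y z w : G,
  adj x y -> adj y z -> adj z w -> adj w x -> x != z -> y != w -> False.
Proof.
move=> n4 x y z w a1 a2 a3 a4 xz yw; apply: n4.
apply: (@cycle_has_subgraph _ [:: x; y; z; w]).
  have ne (u v : G) : adj u v -> u != v by apply: contraTneq => ->; rewrite adj_irrefl.
  by rewrite /= !inE !negb_or (ne _ _ a1) (ne _ _ a2) (ne _ _ a3) xz yw eq_sym (ne _ _ a4).
by rewrite /= a1 a2 a3 a4.
Qed.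

Lemma noC6 : ~ has_subgraph G (cycle_graph 6) -> forall x0 x1 x2 x3 x4 x5 : G,
  uniq [:: x0; x1; x2; x3; x4; x5] -> adj x0 x1 -> adj x1 x2 -> adj x2 x3 ->
  adj x3 x4 -> adj x4 x5 -> adj x5 x0 -> False.
Proof.
move=> n6 x0 x1 x2 x3 x4 x5 u a0 a1 a2 a3 a4 a5; apply: n6.
apply: (@cycle_has_subgraph _ [:: x0; x1; x2; x3; x4; x5]) => //.
by rewrite /= a0 a1 a2 a3 a4 a5.
Qed.

End NoCycles.

Lemma planar_no346_colorable (R : realType) (G : sgraph) : planar R G ->
  ~ has_subgraph G (cycle_graph 3) -> ~ has_subgraph G (cycle_graph 4) ->
  ~ has_subgraph G (cycle_graph 6) -> exists I : pred G, coloring 40 I.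
Proof.
move: {2}(#|G|) (leqnn #|G|) => m; elim: m G => [|m IH] G Gm pG n3 n4 n6.
  by exists predT; split=> x; exfalso; move: Gm; rewrite leqn0 => /eqP/card0_eq/(_ x);
    rewrite inE.
apply: contrapT => nc.
have no3 := noC3 n3.
have ext (v : G) : exists J : pred G,
    (forall x y, x != v -> y != v -> adj x y -> J x -> J y -> False) /\
    (forall x, x != v -> ~~ J x -> #|[pred y | [&& adj x y, y != v & ~~ J y]]| <= 40).
  have [|||||I /del_coloring//] := IH (del v).
  - by rewrite -ltnS; apply: leq_trans (card_del v) Gm.
  - exact: del_planar.
  - by move/del_subgraph/n3.
  - by move/del_subgraph/n4.
  - by move/del_subgraph/n6.
have deg2 (v : G) : 2 <= deg v.
  rewrite leqNgt; apply/negP => dv; apply: nc; have [J [J0 JD]] := ext v.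
  have [allN|/existsNP[w /not_implyP[avw /negP]]] := pselect (forall w, adj v w -> ~~ J w).
    exact: extend_indep J0 JD allN.
  rewrite negbK => Jw; apply: (extend_low no3 J0 JD avw Jw).
    exact: leq_trans (ltnW dv) _.
  move=> w' avw' Jw'; have : #|[set w; w']| <= deg v.
    by apply/subset_leq_card/subsetP => z; rewrite !inE => /orP[] /eqP->.
  rewrite cards2; case: eqP => [e|_]; first by rewrite -e Jw in Jw'.
  by move: dv; case: (deg v) => [|[]].
have low (v : G) : ~~ high v -> 0 < nhigh v.
  rewrite /high -ltnNge => dv; rewrite lt0n; apply/negP => /eqP/card0_eq nh.
  apply: nc; have [J [J0 JD]] := ext v.
  have [allN|/existsNP[w /not_implyP[avw /negP]]] := pselect (forall w, adj v w -> ~~ J w).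
    exact: extend_indep J0 JD allN.
  rewrite negbK => Jw; apply: (extend_low no3 J0 JD avw Jw) => // w' avw' _.
  by have := nh w'; rewrite !inE avw' /= /high => /negbT; rewrite -ltnNge.
have [s [su sm sep]] := planar_rotation pG.
have [x0 _|noG] := pickP (predT : pred G); last first.
  by apply: nc; exists predT; split=> x; have := noG x.
exact: (discharging_contradiction su sm no3 (noC4 n4) (noC6 n6) deg2 low x0 sep).
Qed.

(** * Graphs without odd cycles *)

(** At a repeated vertex a closed walk splits into two shorter ones, and one of them is odd. *)
Lemma odd_closed_walk (T : eqType) (e : rel T) (q : seq T) : cycle e q -> odd (size q) ->
  exists p, [/\ uniq p, cycle e p & odd (size p)].
Proof.
move: {2}(size q) (leqnn (size q)) => m; elim: m q => [|m IH] q qm qc qo.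
  by move: qo; have -> : size q = 0 by lia.
have [qu|] := boolP (uniq q); first by exists q.
have x0 : T by case: q qo {qm qc} => [|x].
case/(uniqPn x0) => i [j [ij jq E]].
pose y := nth x0 q i; pose a := take (j - i).-1 (drop i.+1 q).
pose b := drop (j - i) (drop i.+1 q) ++ take i q.
have rE : rot i q = (y :: a) ++ (y :: b).
  have iq : i < size q by exact: ltn_trans ij jq.
  rewrite /rot (drop_nth x0 iq) -/y /= /a /b; congr (_ :: _).
  rewrite -[in LHS](cat_take_drop (j - i).-1 (drop i.+1 q)) -catA; congr (_ ++ _).
  rewrite (drop_nth x0) ?nth_drop ?size_drop; last by lia.
  have -> : i.+1 + (j - i).-1 = j by lia.
  by rewrite -E -/y (_ : (j - i).-1.+1 = j - i); last lia.
have sz : size a + size b + 2 = size q by rewrite -(size_rot i q) rE size_cat /=; lia.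
move: qc; rewrite -(rot_cycle i) rE /= rcons_cat cat_path /= => /and3P[pa ya yb].
have ca : cycle e (y :: a) by rewrite /= rcons_path pa ya.
have cb : cycle e (y :: b) by [].
have [oa|ob] : odd (size (y :: a)) \/ odd (size (y :: b)).
  by move: qo; rewrite -sz /=; lia.
  by apply: IH ca oa; rewrite /=; lia.
by apply: IH cb ob; rewrite /=; lia.
Qed.

Section Bipartite.
Variable G : sgraph.

(** The bipartite double cover: walks from [(x, false)] to [(x, true)] are the odd closed walks at
    [x]. *)
Definition cover_adj : rel (G * bool) :=
  fun u v => adj u.1 v.1 && (v.2 == ~~ u.2).

Lemma cover_sym : connect_sym cover_adj.
Proof.
apply: sym_connect_sym => -[x b] [y c]; rewrite /cover_adj /= adj_sym.
by case: b; case: c.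
Qed.

Lemma cover_walk u v : connect cover_adj u v ->
  exists p, [/\ path adj u.1 p, last u.1 p = v.1 & odd (size p) = u.2 (+) v.2].
Proof.
case/connectP=> p; elim: p u => [|w p IH] u /=.
  by move=> _ ->; exists [::]; rewrite /= addbb.
case/andP=> /andP[auw /eqP w2] /IH{IH}h /h [q [h1 h2 h3]].
by exists (w.1 :: q); rewrite /= auw h1 h2 h3 w2; split=> //; case: u.2; case: v.2.
Qed.

Lemma walk_cover x p b : path adj x p ->
  connect cover_adj (x, b) (last x p, b (+) odd (size p)).
Proof.
elim: p x b => [|y p IH] x b /=; first by rewrite addbF.
case/andP=> axy /IH h; apply: (@connect_trans _ _ (y, ~~ b)).
  by apply: connect1; rewrite /cover_adj /= axy eqxx.
by have := h (~~ b); rewrite addNb -addbN.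
Qed.

Lemma no_odd_cycle_coloring :
  (forall i, 1 <= i -> ~ has_subgraph G (cycle_graph (2 * i + 1))) ->
  exists I : pred G, coloring 0 I.
Proof.
move=> noodd.
have nox x : ~~ connect cover_adj (x, false) (x, true).
  apply/negP => /cover_walk[p [/= px lx ox]].
  have pc : cycle adj p.
    case: p px lx ox => //= y p /andP[axy py] lx _.
    by rewrite rcons_path py lx.
  have [q [qu qc qo]] := odd_closed_walk pc ox.
  apply: (noodd (size q)./2).
    case: q qu qc qo => [//|y [|z [|w q]]] //= _; first by rewrite adj_irrefl.
  have -> : 2 * (size q)./2 + 1 = size q by rewrite mul2n addn1 -add1n -[in RHS](odd_double_half (size q)) qo.
  exact: cycle_has_subgraph.
pose r (x : G) := fingraph.root adj x.
have asym : connect_sym (@adj G) by apply: sym_connect_sym; apply: adj_sym.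
(* The colour class of the vertices reached by an even walk from the root of their component. *)
pose c x := connect cover_adj (r x, false) (x, false).
have cor x : c x \/ connect cover_adj (r x, false) (x, true).
  have : connect adj (r x) x by rewrite asym connect_root.
  case/connectP=> p rp xE; have := walk_cover false rp.
  by rewrite -xE /c; case: (odd _); [right|left].
have flip x y b : adj x y -> connect cover_adj (x, b) (y, ~~ b).
  by move=> a; apply: connect1; rewrite /cover_adj /= a eqxx.
have rE x y : adj x y -> r x = r y.
  by move=> a; apply/eqP; rewrite root_connect // connect1.
exists c; split=> [x y axy cx cy|x ncx].
  have /negP := nox y; apply; rewrite /c cover_sym in cy; apply: connect_trans cy _.
  by rewrite -(rE _ _ axy); apply: connect_trans cx (flip _ _ false axy).
rewrite leqn0; apply/eqP/eq_card0 => y; rewrite !inE; apply/negP => /andP[axy ncy].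
case: (cor x) => [h|h]; first by rewrite h in ncx.
have := connect_trans h (flip _ _ true axy); rewrite (rE _ _ axy) => h2.
by rewrite /c h2 in ncy.
Qed.

End Bipartite.

(** * Two-page book embeddings *)

Section Tents.
Variable R : realType.
Local Open Scope ring_scope.
Local Open Scope classical_set_scope.
Implicit Types a b z : plane R.

Lemma segmentP a b z : a.1 < b.1 ->
  segment a b z <-> (a.1 <= z.1 <= b.1) /\ z.2 = line a b z.1.
Proof.
move=> ab; have ne : a.1 != b.1 by rewrite lt_eqF.
have d : b.1 - a.1 != 0 by rewrite subr_eq0 eq_sym.
split=> [[t t01 ->] /=|[h E]].
  by split; [nra | rewrite /line /slope; field].
have := segment_line ne (x := z.1); rewrite /btw h => /(_ isT).
by rewrite -E -surjective_pairing.
Qed.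

Lemma segmentC a b : segment a b = segment b a.
Proof.
suff h (c d : plane R) : segment c d `<=` segment d c by apply/seteqP; split; apply: h.
by move=> z [t t01 ->]; exists (1 - t); [lra | congr (_, _); ring].
Qed.

Lemma polygonal_arc2 a m b : a <> m -> m <> b ->
  segment a m `&` segment m b = [set m] ->
  polygonal_arc (segment a m `|` segment m b) a b.
Proof.
move=> am mb E; exists 1%N, (nth b [:: a; m; b]); split=> //.
- by case=> [|[|]].
- by case.
- by move=> i j; lia.
apply/seteqP; split=> z.
  by case=> h; [exists 0%N | exists 1%N].
by case=> -[|[|]] //= _ h; [left | right].
Qed.

(** The sides have slope 2 (j - i) up to sign. With a height linear in the width, all slopes would
    agree, and nested tents with a common foot would overlap along a side. *)
Definition apex (i j : R) (up : bool) : plane R :=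
  ((i + j) / 2, (-1) ^+ (~~ up) * (j - i) ^+ 2).

Definition tent (i j : R) (up : bool) : set (plane R) :=
  segment (i, 0) (apex i j up) `|` segment (apex i j up) (j, 0).

Lemma tent_left i j up z : i < j -> segment (i, 0) (apex i j up) z <->
  (i <= z.1 <= (i + j) / 2) /\ z.2 = (-1) ^+ (~~ up) * (2 * (j - i) * (z.1 - i)).
Proof.
move=> ij; rewrite segmentP /=; last lra.
have -> // : line (i, 0) (apex i j up) z.1 = (-1) ^+ (~~ up) * (2 * (j - i) * (z.1 - i)).
by rewrite /line /slope /=; field; lra.
Qed.

Lemma tent_right i j up z : i < j -> segment (apex i j up) (j, 0) z <->
  ((i + j) / 2 <= z.1 <= j) /\ z.2 = (-1) ^+ (~~ up) * (2 * (j - i) * (j - z.1)).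
Proof.
move=> ij; rewrite segmentP /=; last lra.
have -> // : line (apex i j up) (j, 0) z.1 = (-1) ^+ (~~ up) * (2 * (j - i) * (j - z.1)).
by rewrite /line /slope /=; field; lra.
Qed.

Lemma tentP i j up z : i < j -> tent i j up z -> (i <= z.1 <= j) /\
  z.2 = (-1) ^+ (~~ up) * (2 * (j - i) * Num.min (z.1 - i) (j - z.1)).
Proof.
move=> ij [/tent_left|/tent_right] /(_ ij)[h ->]; split; try lra; congr (_ * (_ * _)).
  by rewrite min_l //; lra.
by rewrite min_r //; lra.
Qed.

Lemma tent_arc i j up : i < j -> polygonal_arc (tent i j up) (i, 0) (j, 0) /\
  polygonal_arc (tent i j up) (j, 0) (i, 0).
Proof.
move=> ij.
have n1 : (i, 0) <> apex i j up by case; lra.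
have n2 : apex i j up <> (j, 0) by case; lra.
have E : segment (i, 0) (apex i j up) `&` segment (apex i j up) (j, 0) = [set apex i j up].
  apply/seteqP; split=> z.
    case=> /(tent_left _ _ ij)[h1 e] /(tent_right _ _ ij)[h2 _] /=.
    have z1 : z.1 = (i + j) / 2 by lra.
    by rewrite /apex [z]surjective_pairing e z1; congr (_, _ * _); field.
  by move=> ->; split; [apply: segment_r | apply: segment_l].
split; first exact: polygonal_arc2.
rewrite /tent classical_sets.setUC [segment (i, 0) _]segmentC [segment _ (j, 0)]segmentC.
apply: polygonal_arc2; [by move/esym | by move/esym|].
by rewrite classical_sets.setIC [segment (j, 0) _]segmentC [segment _ (i, 0)]segmentC.
Qed.

Lemma sign_pos_inj (u v : bool) (s t : R) : 0 < s -> 0 <= t ->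
  (-1) ^+ (~~ u) * s = (-1) ^+ (~~ v) * t -> u = v /\ s = t.
Proof. by case: u; case: v => /= s0 t0; rewrite ?expr0 ?expr1; split=> //; lra. Qed.

End Tents.

(* Two-page book embeddings: the vertices lie on the horizontal axis, and the
   edges are drawn as tents whose sides get steeper with their width, so that
   nested tents of the same page do not meet. *)
Definition book_embedding (G : sgraph) (rho : G -> nat) (page : G -> G -> bool) : Prop :=
  [/\ injective rho, forall x y, page x y = page y x &
    forall x y z w, adj x y -> adj z w -> rho x < rho z -> rho z < rho y ->
      rho y < rho w -> page x y = page z w -> False].

Lemma book_planar (R : realType) (G : sgraph) rho page :
  @book_embedding G rho page -> planar R G.
Proof.
case=> rho_inj pageC nocross.
pose pos (x : G) : plane R := ((rho x)%:R%R, 0%R).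
pose tn (x y : G) := tent (rho x)%:R%R (rho y)%:R%R (page x y) : set (plane R).
pose arc (e : {set G}) : set (plane R) :=
  (fun z => exists x y, [/\ e = [set x; y], rho x < rho y & tn x y z]).
have arcE x y : rho x < rho y -> arc [set x; y] = tn x y.
  move=> xy; apply/seteqP; split=> z; last by exists x, y.
  case=> x' [y' [E xy' h]].
  have [] : x \in [set x'; y'] /\ y \in [set x'; y'] by rewrite -E !inE !eqxx orbT.
  rewrite !inE => /orP[] /eqP ex /orP[] /eqP ey; subst x y; rewrite ?ltnn // in xy.
  by have := ltn_trans xy xy'; rewrite ltnn.
have adj_lt x y : adj x y -> rho x < rho y \/ rho y < rho x.
  move=> a; case: (ltngtP (rho x) (rho y)) => [||/rho_inj e]; [by left|by right|].
  by rewrite e adj_irrefl in a.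
have ltR x y : rho x < rho y -> ((rho x)%:R < (rho y)%:R :> R)%R by rewrite ltr_nat.
have leR x y : rho x <= rho y -> ((rho x)%:R <= (rho y)%:R :> R)%R by rewrite ler_nat.
have key x y x' y' z : adj x y -> adj x' y' -> rho x < rho y -> rho x' < rho y' ->
    (x, y) <> (x', y') -> z <> pos x -> z <> pos y -> tn x y z -> tn x' y' z -> False.
  move=> a a' xy xy' ne nx ny /(tentP (ltR _ _ xy))[h E] /(tentP (ltR _ _ xy'))[h' E'].
  have l1 := ltR _ _ xy; have l2 := ltR _ _ xy'.
  set t := z.1 in h E h' E'.
  set m := Num.min (t - _)%R _ in E; set m' := Num.min (t - _)%R _ in E'.
  have m0 : (0 < m)%R.
    have : (0 <= m)%R by rewrite /m le_min !subr_ge0.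
    rewrite le_eqVlt => /orP[/eqP m0|//]; rewrite -m0 !mulr0 in E.
    move: m0; rewrite /m; case: (leP (t - (rho x)%:R)%R) => _ e0; exfalso.
      by apply: nx; rewrite [z]surjective_pairing E /pos; congr (_, _); rewrite -/t; lra.
    by apply: ny; rewrite [z]surjective_pairing E /pos; congr (_, _); rewrite -/t; lra.
  have m0' : (0 <= m')%R by rewrite /m' le_min !subr_ge0.
  have P : (0 < 2 * ((rho y)%:R - (rho x)%:R) * m)%R by apply: mulr_gt0 => //; lra.
  rewrite E' in E; have [||pg TE] := sign_pos_inj _ _ (esym E).
  - exact: P.
  - by apply: mulr_ge0 => //; lra.
  have m1 : (0 < m')%R by rewrite lt_neqAle m0' andbT; apply/eqP => e; move: P; rewrite TE -e mulr0 ltxx.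
  have T1 : ((rho x)%:R < t < (rho y)%:R)%R.
    by move: m0; rewrite /m lt_min !subr_gt0.
  have T2 : ((rho x')%:R < t < (rho y')%:R)%R.
    by move: m1; rewrite /m' lt_min !subr_gt0.
  have c1 : rho x < rho y' by rewrite -(ltr_nat R); lra.
  have c2 : rho x' < rho y by rewrite -(ltr_nat R); lra.
  (* Over a common abscissa the wider tent is strictly higher: its slope is larger and its ends are
     at least as far away. *)
  have nest (u v u' v' : G) (k k' : R) : rho u <= rho u' -> rho v' <= rho v -> (u, v) <> (u', v') ->
     k = Num.min (t - (rho u)%:R)%R ((rho v)%:R - t)%R ->
     k' = Num.min (t - (rho u')%:R)%R ((rho v')%:R - t)%R -> (0 < k)%R -> (0 < k')%R ->
     ((rho u')%:R < (rho v')%:R :> R)%R ->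
     (2 * ((rho v)%:R - (rho u)%:R) * k <> 2 * ((rho v')%:R - (rho u')%:R) * k')%R.
    move=> hu hv hne kE kE' k0 k0' l.
    have kk : (k' <= k)%R.
      have := leR _ _ hu; have := leR _ _ hv; rewrite kE kE' le_min => r1 r2.
      by apply/andP; split; rewrite ge_min; apply/orP; [left|right]; lra.
    have LL : ((rho v')%:R - (rho u')%:R < (rho v)%:R - (rho u)%:R :> R)%R.
      have : rho u < rho u' \/ rho v' < rho v.
        case: (ltngtP (rho u) (rho u')) hu => [||/rho_inj e] //; first by left.
        case: (ltngtP (rho v') (rho v)) hv => [||/rho_inj e'] //; first by right.
        by rewrite e e' in hne.
      have := leR _ _ hu; have := leR _ _ hv; move=> r1 r2 [] /ltR; lra.
    by nra.
  case: (ltngtP (rho x) (rho x')) => [xx|xx|/rho_inj xx].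
  - case: (leqP (rho y') (rho y)) => yy; last by case: (nocross _ _ _ _ a a' xx c2 yy pg).
    by apply: (nest x y x' y' m m') => //; [exact: ltnW].
  - case: (leqP (rho y) (rho y')) => yy.
      by apply: (nest x' y' x y m' m) => //; [exact: ltnW | apply: nesym].
    by case: (nocross _ _ _ _ a' a xx c1 yy (esym pg)).
  - case: (leqP (rho y') (rho y)) => yy.
      by apply: (nest x y x' y' m m'); rewrite // xx.
    apply: (nest x' y' x y m' m) => //; first by rewrite xx.
      exact: ltnW.
    by apply: nesym.
exists pos, arc; split.
- move=> x y [] /eqP; rewrite eqr_nat => /eqP; exact: rho_inj.
- move=> x y a; case: (adj_lt _ _ a) => h.
    by rewrite arcE //; have [] := tent_arc (page x y) (ltR _ _ h).
  rewrite setUC (arcE y x) //.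
  by have [] := tent_arc (page y x) (ltR _ _ h).
- have vert x y z : rho x < rho y -> tn x y (pos z) -> z = x \/ z = y.
    move=> h /(tentP (ltR _ _ h))[/= h' E]; have l := ltR _ _ h.
    move/esym/eqP: E; rewrite mulf_eq0 signr_eq0 /= mulf_eq0 => /orP[/eqP|/eqP].
      by move=> e; exfalso; clear -e l; lra.
    case: leP => _ /eqP; rewrite subr_eq0 eqr_nat => /eqP /rho_inj; auto.
  move=> x y z a [h /= hn]; apply: hn; case: (adj_lt _ _ a) => xy.
    by move: h; rewrite arcE // => /(vert _ _ _ xy)[->|->]; [left|right].
  by move: h; rewrite setUC (arcE y x) // => /(vert _ _ _ xy)[->|->]; [right|left].
- move=> x y x' y' a a' ne; apply/seteqP; split=> // z [[h hn] h'].
  have ax : adj y x by rewrite adj_sym. have ax' : adj y' x' by rewrite adj_sym.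
  have nx : z <> pos x by move=> e; apply: hn; left.
  have ny : z <> pos y by move=> e; apply: hn; right.
  case: (adj_lt _ _ a) => xy; case: (adj_lt _ _ a') => xy'.
  + rewrite !arcE // in h h'; apply: (key x y x' y' z) => // -[e1 e2].
    by apply: ne; rewrite e1 e2.
  + rewrite (setUC [set x']) !arcE // in h h'; apply: (key x y y' x' z) => // -[e1 e2].
    by apply: ne; rewrite e1 e2 setUC.
  + rewrite (setUC [set x]) !arcE // in h h'; apply: (key y x x' y' z) => // -[e1 e2].
    by apply: ne; rewrite e1 e2 setUC.
  + rewrite (setUC [set x]) (setUC [set x']) !arcE // in h h'; apply: (key y x y' x' z) => // -[e1 e2].
    by apply: ne; rewrite e1 e2.
Qed.

(** * Joining gadgets at a new root *)

(** A cycle is a periodic sequence of exact period [k], so no position is distinguished as its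
    start. *)
Definition closed_walk (G : sgraph) (k : nat) (f : nat -> G) : Prop :=
  (forall t, adj (f t) (f t.+1)) /\ (forall t u, (f t == f u) = (t == u %[mod k])).

Lemma subgraph_closed_walk (G : sgraph) k : 3 <= k -> has_subgraph G (cycle_graph k) ->
  exists f, @closed_walk G k f.
Proof.
case: k => // k k3 [f finj fadj]; exists (fun t => f (inord (t %% k.+1))).
have vi t : (inord (t %% k.+1) : 'I_k.+1) = t %% k.+1 :> nat.
  by rewrite inordK // ltn_pmod.
split=> t => [|u].
  have e : (t %% k.+1).+1 %% k.+1 = t.+1 %% k.+1 by rewrite -addn1 modnDml addn1.
  have ne : t %% k.+1 != t.+1 %% k.+1.
    have := eqn_modDl t 0 1 k.+1; rewrite addn0 addn1 => ->.
    by rewrite !modn_small //; lia.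
  by apply: fadj; rewrite [adj _ _]/(cycle_adj _ _) /cycle_adj /= -!val_eqE /= !vi ne e eqxx.
by rewrite (inj_eq finj) -val_eqE /= !vi.
Qed.

Definition cycles_in (G : sgraph) (L : nat -> Prop) : Prop :=
  forall k f, 3 <= k -> @closed_walk G k f -> L k.

(** A leftmost root can be joined to a new vertex further left without crossings. *)
Definition rooted_book (G : sgraph) (r : G) : Prop :=
  exists rho page, @book_embedding G rho page /\ forall x, rho r <= rho x.

Definition forced_in (D : nat) (G : sgraph) (r : G) : Prop :=
  forall I : pred G, coloring D I -> I r.

Definition forced_out (D : nat) (G : sgraph) (r : G) : Prop :=
  forall I : pred G, coloring D I -> ~~ I r.

Lemma coloring_restrict D (G H : sgraph) (f : H -> G) (I : pred G) : injective f ->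
  (forall x y, adj x y -> adj (f x) (f y)) -> coloring D I -> coloring D (fun x => I (f x)).
Proof.
move=> finj fadj [I0 ID]; split=> [x y /fadj|x /ID]; first exact: I0.
apply: leq_trans; rewrite -(card_imset _ finj); apply/subset_leq_card/subsetP => z.
by case/imsetP=> y; rewrite !inE => /andP[/fadj a Iy] ->; rewrite a.
Qed.

Section Star.
Variables (A B : sgraph) (rA : A) (rB : B) (N : nat).

Definition star_vertex : finType := option (A + 'I_N * B).

Definition star_adj : rel star_vertex := fun u v =>
  match u, v with
  | None, Some (inl a) | Some (inl a), None => a == rA
  | None, Some (inr b) | Some (inr b), None => b.2 == rB
  | Some (inl a), Some (inl a') => adj a a'
  | Some (inr b), Some (inr b') => (b.1 == b'.1) && adj b.2 b'.2
  | _, _ => false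
  end.

Lemma star_adj_sym : symmetric star_adj.
Proof. by case=> [[a|b]|] [[a'|b']|] //=; rewrite 1?eq_sym adj_sym. Qed.

Lemma star_adj_irrefl : irreflexive star_adj.
Proof. by case=> [[a|b]|] //=; rewrite adj_irrefl ?andbF. Qed.

Definition star : sgraph := SGraph star_adj_sym star_adj_irrefl.
Definition star_root : star := None.

(* The root of the star is a cut vertex that meets each branch in a single
   edge, hence lies on no cycle. *)
Lemma star_cycles L : cycles_in A L -> cycles_in B L -> cycles_in star L.
Proof.
move=> cA cB k f k3 [fadj finj].
have k0 : 0 < k by exact: leq_trans k3.
pose branch (u : star) : option (option 'I_N) :=
  match u with None => None | Some (inl _) => Some None | Some (inr b) => Some (Some b.1) end.
have branch_adj (u v : star) : adj u v -> u != None -> v != None -> branch u = branch v.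
  by case: u => [[a|b]|]; case: v => [[a'|b']|] //= /andP[/eqP-> _].
have branch_root (u v : star) : adj star_root u -> adj star_root v -> branch u = branch v -> u = v.
  case: u => [[a|[i b]]|]; case: v => [[a'|[i' b']]|] //=.
    by move=> /eqP-> /eqP->.
  by move=> /eqP-> /eqP-> [->].
have noNone t : f t != None.
  apply/eqP; rewrite -[None]/star_root => ft.
  have nz u : 0 < u < k -> f (t + u) != star_root.
    by move=> h; rewrite -ft finj -{2}(addn0 t) eqn_modDl mod0n modn_small //; lia.
  have bc u : 0 < u < k -> branch (f (t + u)) = branch (f (t + 1)).
    elim: u => // -[|u] IH h //; rewrite -IH; last lia.
    apply/esym/branch_adj; [rewrite [t + u.+2]addnS; exact: fadj | apply: nz; lia | exact: nz].
  have e : f (t + k.-1) = f (t + 1).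
    apply: branch_root; [|by rewrite -ft addn1|by apply: bc; lia].
    have -> : star_root = f (t + k) by rewrite -ft; apply/esym/eqP; rewrite finj modnDr.
    have -> : t + k = (t + k.-1).+1 by rewrite -addnS prednK.
    by rewrite adj_sym; exact: fadj.
  move/eqP: e; rewrite finj eqn_modDl !modn_small; lia.
have bc t : branch (f t) = branch (f 0).
  by elim: t => // t <-; apply/esym/branch_adj.
case E: (f 0) => [[a0|[i0 b0]]|]; last by have := noNone 0; rewrite E.
  pose g t := if f t is Some (inl a) then a else a0.
  have fg t : f t = Some (inl (g t)).
    by rewrite /g; have := bc t; rewrite E /=; case: (f t) => [[a|b]|].
  apply: (cA k g k3); split=> [t|t u]; first by have := fadj t; rewrite !fg.
  by rewrite -finj !fg.
pose g t := if f t is Some (inr b) then b.2 else b0.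
have fg t : f t = Some (inr (i0, g t)).
  by rewrite /g; have := bc t; rewrite E /=; case: (f t) => [[a|[i b]]|] //= [->].
apply: (cB k g k3); split=> [t|t u]; first by have := fadj t; rewrite !fg /= eqxx.
rewrite -finj !fg; apply/eqP/eqP => [->//|[]//].
Qed.

(** The new root comes first, then [A], then the copies of [B] in consecutive blocks. Its edges end
    at the leftmost vertices of blocks, which no edge of a block passes over. *)
Lemma star_book : rooted_book rA -> rooted_book rB -> rooted_book star_root.
Proof.
move=> [rhoA [pA [[iA sA nA] mA]]] [rhoB [pB [[iB sB nB] mB]]].
have [MA bA] : exists M, forall a, rhoA a < M.
  by exists (\max_a rhoA a).+1 => a; rewrite ltnS; apply: leq_bigmax.
have [MB bB] : exists M, forall b, rhoB b < M.
  by exists (\max_b rhoB b).+1 => b; rewrite ltnS; apply: leq_bigmax.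
pose rho (u : star) := match u with
  | None => 0 | Some (inl a) => (rhoA a).+1
  | Some (inr b) => (MA + b.1 * MB + rhoB b.2).+1 end.
pose page (u v : star) := match u, v with
  | Some (inl a), Some (inl a') => pA a a'
  | Some (inr b), Some (inr b') => pB b.2 b'.2
  | _, _ => true end.
have lexB (b b' : 'I_N * B) : b.1 * MB + rhoB b.2 < b'.1 * MB + rhoB b'.2 -> b.1 <= b'.1.
  move=> h; rewrite leqNgt; apply/negP => lt.
  have : b'.1 * MB + MB <= b.1 * MB by rewrite addnC -mulSn leq_mul2r lt orbT.
  by have := bB b'.2; move: h; move: (b'.1 * MB) (b.1 * MB) => m n; lia.
exists rho, page; split=> //; split.
- case=> [[a|[i b]]|] [[a'|[i' b']]|] //=.
  + by case=> /iA->.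
  + by case=> e; have := bA a; rewrite e -addnA ltnNge leq_addr.
  + by case=> e; have := bA a'; rewrite -e -addnA ltnNge leq_addr.
  + case=> /eqP; rewrite -!addnA eqn_add2l => /eqP e.
    have ei : i = i'.
      apply: val_inj => /=; have := bB b; have := bB b' => h1 h2.
      have MB0 : 0 < MB by exact: leq_ltn_trans (bB b).
      by have := congr1 (fun n => n %/ MB) e; rewrite /= !divnMDl // !divn_small // !addn0.
    by move: e; rewrite ei => /addnI/iB->.
- by case=> [[a|b]|] [[a'|b']|] //=.
- have lowA (a : A) (b : 'I_N * B) : (rhoA a).+1 < (MA + b.1 * MB + rhoB b.2).+1.
    by rewrite ltnS -addnA ltn_addr.
  have lowB (b b' : 'I_N * B) : b.2 == rB ->
      b'.1 = b.1 -> rho (Some (inr b) : star) <= rho (Some (inr b') : star).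
    by rewrite /rho => /eqP-> ->; rewrite ltnS leq_add2l.
  have sameB (b1 b2 b3 : 'I_N * B) : b1.1 = b3.1 ->
      rho (Some (inr b1)) < rho (Some (inr b2)) -> rho (Some (inr b2)) < rho (Some (inr b3)) ->
      b2.1 = b1.1.
    rewrite /rho !ltnS -!addnA !ltn_add2l => e13 /lexB h1 /lexB h2.
    by apply: val_inj; apply/eqP; rewrite eqn_leq h1 e13 h2.
  move=> x y z w; case: z => [[a3|b3]|] //; case: w => [[a4|b4]|] //=.
  + case: x => [[a1|b1]|] //; case: y => [[a2|b2]|] //= axy azw.
    * exact: nA.
    * by rewrite ltnNge (ltnW (lowA _ _)).
    * move: axy => /eqP->; rewrite !ltnS => _ h; exfalso.
      by move: h; rewrite ltnNge mA.
    * by move=> _ _; rewrite ltnNge (ltnW (lowA _ _)).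
  + case: x => [[a1|b1]|] //; case: y => [[a2|b2]|] //= axy /andP[/eqP e34 a34] h1 h2 h3.
    * by move: h2; rewrite ltnNge (ltnW (lowA _ _)).
    * move: axy => /andP[/eqP e12 a12].
      have e31 : b3.1 = b1.1 by apply: (sameB _ _ b2).
      apply: nB a12 a34 _ _ _; move: h1 h2 h3; rewrite /rho -e12 -e34 e31 !ltnS !ltn_add2l //.
    * by move: h2; rewrite ltnNge (ltnW (lowA _ _)).
    * have e : b2.1 = b3.1 by apply: (sameB _ _ b4).
      by have := lowB _ b3 axy (esym e); rewrite /rho leqNgt h2.
Qed.

Lemma star_inl D (I : pred star) : coloring D I -> coloring D (fun a => I (Some (inl a))).
Proof. by apply: coloring_restrict => // a a' []. Qed.

Lemma star_inr D (I : pred star) i : coloring D I -> coloring D (fun b => I (Some (inr (i, b)))).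
Proof. by apply: coloring_restrict => [b b' []|b b' /= ->] //; rewrite eqxx. Qed.

Lemma star_forced_out D : forced_in D rA -> forced_out D star_root.
Proof.
move=> fA I cI; apply/negP => Ir; have [I0 _] := cI.
by apply: (I0 star_root (Some (inl rA))) => //=; apply: fA (star_inl cI).
Qed.

Lemma star_forced_in D : D < N -> forced_out D rB -> forced_in D star_root.
Proof.
move=> DN fB I cI; apply: contraTT DN => nI; rewrite -leqNgt; have [_ ID] := cI.
apply: leq_trans (ID _ nI); rewrite -[X in X <= _]card_ord.
have inj : injective (fun i : 'I_N => Some (inr (i, rB)) : star) by move=> i j [].
rewrite -(card_imset _ inj); apply/subset_leq_card/subsetP => _ /imsetP[i _ ->].
by rewrite inE /= eqxx; apply: fB (star_inr i cI).
Qed.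

End Star.

(** Fills a slot of a star that has no gadget to hold. *)
Definition point_graph : sgraph :=
  @SGraph unit (fun _ _ => false) (fun _ _ => erefl) (fun _ => erefl).

Lemma point_cycles L : cycles_in point_graph L.
Proof. by move=> k f k3 [/(_ 0)]. Qed.

Lemma point_book : @rooted_book point_graph tt.
Proof. by exists (fun=> 0), (fun _ _ => true); split=> //; split=> // -[] []. Qed.

(** One root forced into [I] forces an adjacent new root out, and [D.+1] roots forced out force a
    common neighbour in. So either kind of gadget yields the other, and a new root joined to both
    kinds has no colour left. *)
Lemma forced_obstruction (R : realType) D L (G : sgraph) (r : G) :
  rooted_book r -> cycles_in G L -> forced_in D r \/ forced_out D r ->
  exists H : sgraph, [/\ planar R H, cycles_in H L & ~ colorable [tuple 0; D] H].
Proof.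
have main (A B : sgraph) (a : A) (b : B) : rooted_book a -> rooted_book b ->
    cycles_in A L -> cycles_in B L -> forced_in D a -> forced_out D b ->
    exists H : sgraph, [/\ planar R H, cycles_in H L & ~ colorable [tuple 0; D] H].
  move=> ba bb ca cb fa fb; exists (star a b D.+1); split.
  - by have [rho [page [h _]]] := star_book D.+1 ba bb; apply: book_planar h.
  - exact: star_cycles.
  - case/colorableP=> I cI; have := star_forced_out fa cI.
    by rewrite (star_forced_in (ltnSn D) fb cI).
move=> br cr [fr|fr].
  apply: (main _ _ r (@star_root G point_graph r tt 0)) => //.
  - exact: star_book point_book.
  - exact: star_cycles (point_cycles _).
  - exact: star_forced_out.
apply: (main _ _ (@star_root point_graph G tt r D.+1) r) => //.
- exact: star_book point_book _.
- by apply: star_cycles => //; apply: point_cycles.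
- exact: star_forced_in.
Qed.

(** * Blown-up cycles *)

Section Bundles.
Variables (G : sgraph) (D N : nat) (I : pred G) (u v : G).
Hypothesis cI : coloring D I.

Lemma few_out (w : 'I_N -> G) : injective w -> (forall i, adj u (w i)) -> ~~ I u ->
  #|[pred i | ~~ I (w i)]| <= D.
Proof.
move=> winj uw Iu; have [_ ID] := cI; apply: leq_trans (ID u Iu).
rewrite -(card_imset _ winj); apply/subset_leq_card/subsetP => _ /imsetP[i Ii ->].
by rewrite inE uw.
Qed.

(** The common neighbours all lie outside [I] with [v], and there are more than [D] of them. *)
Lemma bundle2 (w : 'I_N -> G) : D < N -> injective w ->
  (forall i, adj u (w i)) -> (forall i, adj v (w i)) -> I u -> I v.
Proof.
move=> DN winj uw vw Iu; apply: contraTT DN => Iv; rewrite -leqNgt.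
have [I0 ID] := cI; apply: leq_trans (ID v Iv).
rewrite -[X in X <= _]card_ord -(card_imset _ winj).
apply/subset_leq_card/subsetP => _ /imsetP[i _ ->]; rewrite inE vw /=.
by apply/negP => /(I0 _ _ (uw i) Iu).
Qed.
End Bundles.

(** Each end has at most [D] neighbours outside [I], so among more than [2 * D] paths one has both
    inner vertices in [I]. *)
Lemma bundle3 (G : sgraph) D N (I : pred G) u v (a b : 'I_N -> G) : coloring D I ->
  2 * D < N -> injective a -> injective b -> (forall i, adj u (a i)) ->
  (forall i, adj (a i) (b i)) -> (forall i, adj v (b i)) -> ~~ I u -> ~~ I v -> False.
Proof.
move=> cI DN ainj binj ua ab vb Iu Iv; have [I0 _] := cI.
have ha := few_out cI ainj ua Iu; have hb := few_out cI binj vb Iv.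
have : #|'I_N| <= #|[predU [pred i | ~~ I (a i)] & [pred i | ~~ I (b i)]]|.
  apply/subset_leq_card/subsetP => i _; rewrite !inE -negb_and.
  by apply/negP => /andP[Ia Ib]; apply: I0 (ab i) Ia Ib.
rewrite card_ord => h; have := cardUI [pred i | ~~ I (a i)] [pred i | ~~ I (b i)].
move: h ha hb; move: #|_| #|_| #|_| #|_| => x y z t; lia.
Qed.

Section Ring.
(* A cycle of length n + 1 whose vertices at the positions in [mult] are
   replaced by m + 1 copies. *)
Variables (n m : nat) (mult : nat -> bool).

Definition ring_ok : pred ('I_n.+1 * 'I_m.+1) := fun v => mult v.1 || (v.2 == ord0).
Definition ring_vertex : finType := {v | ring_ok v}.

(** Copies at consecutive multiplied positions are matched by index, which yields parallel paths; a
    single vertex is joined to every copy at a neighbouring position. *)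
Definition ring_adj : rel ring_vertex := fun u v =>
  [&& (val u).1 != (val v).1,
      (ordS (val u).1 == (val v).1) || (ordS (val v).1 == (val u).1) &
      mult (val u).1 && mult (val v).1 ==> ((val u).2 == (val v).2)].

Lemma ring_adj_sym : symmetric ring_adj.
Proof.
by move=> u v; rewrite /ring_adj eq_sym orbC [mult _ && _]andbC [(val u).2 == _]eq_sym.
Qed.

Lemma ring_adj_irrefl : irreflexive ring_adj.
Proof. by move=> u; rewrite /ring_adj eqxx. Qed.

Definition ring : sgraph := SGraph ring_adj_sym ring_adj_irrefl.

Lemma ring_root_ok : ring_ok (ord0, ord0).
Proof. by rewrite /ring_ok eqxx orbT. Qed.

Definition ring_root : ring := exist (fun v => ring_ok v) _ ring_root_ok.
Definition vx (p : nat) (a : 'I_m.+1) : ring := insubd ring_root (inord p, a).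

Lemma vxE p a : p <= n -> mult p || (a == ord0) -> val (vx p a) = (inord p, a).
Proof. by move=> pn ok; rewrite /vx val_insubd /ring_ok inordK // ok. Qed.

Lemma vx0 : vx 0 ord0 = ring_root.
Proof.
apply: val_inj; rewrite vxE ?eqxx ?orbT //=; congr (_, _).
by apply: val_inj; rewrite /= inordK.
Qed.

Lemma vx_inj p : p <= n -> mult p -> injective (vx p).
Proof. by move=> pn mp a b /(congr1 val); rewrite !vxE ?mp // => -[]. Qed.

Lemma vx_adj p a b : p < n -> mult p || (a == ord0) -> mult p.+1 || (b == ord0) ->
  (mult p -> mult p.+1 -> a = b) -> adj (vx p a) (vx p.+1 b).
Proof.
move=> pn oka okb ab; rewrite [adj _ _]/(ring_adj _ _) /ring_adj !vxE //; last exact: ltnW.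
rewrite -!val_eqE /= !inordK //; last exact: leqW.
rewrite modn_small // eqxx /= neq_ltn ltnSn /=.
by apply/implyP => /andP[h1 h2]; rewrite ab.
Qed.

Lemma vx_close a : 0 < n -> ~~ mult 0 -> mult n || (a == ord0) -> adj (vx n a) (vx 0 ord0).
Proof.
move=> n0 m0 oka; rewrite [adj _ _]/(ring_adj _ _) /ring_adj !vxE ?eqxx ?orbT //.
rewrite -!val_eqE /= !inordK // modnn eqxx (negPf m0) andbF /= andbT.
by rewrite -lt0n.
Qed.

Definition mv (d : bool) : 'I_n.+1 -> 'I_n.+1 := if d then @ordS _ else @ord_pred _.
Definition mvn (d : bool) (p : nat) : nat :=
  if d then (if p == n then 0 else p.+1) else (if p == 0 then n else p.-1).

Lemma val_mv d p : mv d p = mvn d p :> nat.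
Proof.
have pn := ltn_ord p; case: d => /=.
  case: eqP => [->|ne]; first by rewrite modnn.
  by rewrite modn_small //; lia.
case: eqP => [->|ne]; first by rewrite add0n /= modn_small.
have -> : (p + n.+1).-1 = p.-1 + n.+1 by lia.
by rewrite modnDr modn_small //; lia.
Qed.

Lemma mvK d : cancel (mv d) (mv (~~ d)).
Proof.
move=> p; apply: ord_inj; rewrite !val_mv; have := ltn_ord p.
move: (p : nat) => q qn; rewrite /mvn; case: d => /=.
  by case: (eqVneq q n).
case: (eqVneq q 0) => [->|q0]; first by rewrite eqxx.
have -> : (q.-1 == n) = false by apply/eqP; lia.
by rewrite prednK // lt0n.
Qed.

Lemma val_iter_ordS t (p : 'I_n.+1) : iter t (@ordS _) p = (p + t) %% n.+1 :> nat.
Proof.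
elim: t => [|t IH]; first by rewrite addn0 modn_small.
by rewrite iterS /= IH addnS -addn1 modnDml addn1.
Qed.

Lemma iter_ordS_id t (p : 'I_n.+1) : (iter t (@ordS _) p == p) = (n.+1 %| t).
Proof.
rewrite -val_eqE /= val_iter_ordS -[X in _ == X](modn_small (ltn_ord p)).
by rewrite -[X in _ == X %% _]addn0 eqn_modDl mod0n.
Qed.

Lemma ring_nbr_unique (u v w : ring) : adj u v -> adj u w ->
  (val v).1 = (val w).1 -> mult (val u).1 || ~~ mult (val v).1 -> v = w.
Proof.
move=> /and3P[_ _ iv] /and3P[_ _ iw] e h; apply: val_inj.
rewrite [LHS]surjective_pairing [RHS]surjective_pairing e; congr (_, _).
have := valP v; have := valP w; rewrite /ring_ok e.
move: h iv iw; rewrite e; case: (mult (val w).1) => /=.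
  by rewrite orbF => -> /= /eqP<- /eqP.
by move=> _ _ _ /eqP-> /eqP->.
Qed.

(** * Cycle lengths in a blown-up cycle *)

Section Walk.
Variables (k : nat) (f : nat -> ring).
Hypotheses (n2 : 2 <= n) (mult0 : ~~ mult 0) (k3 : 3 <= k) (fW : closed_walk k f).

Let ps t := (val (f t)).1.
Let dr t := ordS (ps t) == ps t.+1.

Let fadj t : adj (f t) (f t.+1). Proof. by case: fW. Qed.
Let feq t u : (f t == f u) = (t == u %[mod k]). Proof. by case: fW. Qed.

Let feqD t u : (f (t + u) == f t) = (k %| u).
Proof. by rewrite feq -[X in _ == X %% _]addn0 eqn_modDl mod0n. Qed.

Let psS t : ps t.+1 = mv (dr t) (ps t).
Proof.
rewrite /dr; case: eqP => [<-//|h]; have /and3P[_ /orP[/eqP//|/eqP h' _]] := fadj t.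
have -> : ps t = mv true (ps t.+1) by exact: esym h'.
exact: esym (mvK true _).
Qed.

Let psP t : ps t = mv (~~ dr t) (ps t.+1).
Proof. by rewrite psS mvK. Qed.

(** A copy has only one neighbour on each side, so turning back there would repeat a vertex after
    two steps, against k >= 3. *)
Let persist t : mult (ps t.+1) -> dr t.+1 = dr t.
Proof.
move=> mt; have [->//|ne] := @eqVneq _ (dr t.+1) (dr t); exfalso.
have e : dr t.+1 = ~~ dr t by case: (dr t.+1) (dr t) ne => [] [].
have : f t.+2 == f t.
  apply/eqP; apply: (@ring_nbr_unique (f t.+1)) => //.
  - by rewrite adj_sym.
  - by rewrite -/(ps _) -/(ps _) psS e -psP.
  - by rewrite -/(ps _) mt.
by rewrite -addn2 feqD => /dvdn_leq; lia.
Qed.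

(** Turns happen only at single vertices, from one copy of a neighbouring position to another. *)
Let flip t : dr t.+1 != dr t ->
  [/\ ~~ mult (ps t.+1), mult (ps t), dr t.+1 = ~~ dr t & ps t.+2 = ps t].
Proof.
move=> ne; have e : dr t.+1 = ~~ dr t by case: (dr t.+1) (dr t) ne => [] [].
have ep : ps t.+2 = ps t by rewrite psS e -psP.
split=> //; first by apply/negP => /persist e'; rewrite e' eqxx in ne.
apply/negPn/negP => nm; have : f t.+2 == f t.
  apply/eqP; apply: (@ring_nbr_unique (f t.+1)) => //; first by rewrite adj_sym.
  by rewrite -/(ps t.+2) ep nm orbT.
by rewrite -addn2 feqD => /dvdn_leq; lia.
Qed.

Let single_eq t u : ps t = ps u -> ~~ mult (ps t) -> f t = f u.
Proof.
move=> e nm; apply: val_inj; rewrite [LHS]surjective_pairing [RHS]surjective_pairing.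
congr (_, _) => //; have := valP (f t); have := valP (f u).
by rewrite /ring_ok -/(ps _) -/(ps _) -e (negPf nm) /= => /eqP-> /eqP->.
Qed.

(** A walk without turns is back at position 0 exactly every [n.+1] steps, and this position has
    just one vertex. *)
Lemma no_flip : (forall t, dr t.+1 = dr t) -> k = n.+1.
Proof.
move=> nf; have dE t : dr t = dr 0 by elim: t => // t <-.
have rel t u : if dr 0 then ps (t + u) = iter u (@ordS _) (ps t)
    else ps t = iter u (@ordS _) (ps (t + u)).
  elim: u => [|u]; first by rewrite addn0; case: ifP.
  have := psS (t + u); have := psP (t + u); rewrite addnS dE.
  by case: (dr 0) => h1 h2 IH; [rewrite h2 IH | rewrite iterSr IH [in LHS]h1].
have iter_inj u : injective (iter u (@ordS n.+1)).
  by elim: u => // u IH x y /= /(can_inj (@mvK true))/IH.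
have [t0 t0P] : exists t, ps t = ord0.
  have p0 := ltn_ord (ps 0).
  case E: (dr 0).
    exists (n.+1 - ps 0); have := rel 0 (n.+1 - ps 0); rewrite E add0n => ->.
    apply: val_inj; rewrite /= val_iter_ordS subnKC ?modnn //; exact: ltnW.
  exists (ps 0); have := rel 0 (ps 0); rewrite E add0n => e.
  apply: (iter_inj (ps 0)); rewrite -e; apply: val_inj.
  by rewrite /= val_iter_ordS add0n modn_small.
have per u : (ps (t0 + u) == ps t0) = (n.+1 %| u).
  have := rel t0 u; case: ifP => _ e; first by rewrite e iter_ordS_id.
  by rewrite eq_sym [X in X == _]e iter_ordS_id.
have kL : k %| n.+1.
  rewrite -(feqD t0); apply/eqP/single_eq; last first.
    by have /eqP -> : ps (t0 + n.+1) == ps t0; rewrite ?per ?dvdnn // t0P.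
  by apply/eqP; rewrite per.
have Lk : n.+1 %| k.
  by rewrite -per; apply/eqP; rewrite /ps; congr (val _).1; apply/eqP; rewrite feqD.
by apply/eqP; rewrite eqn_dvd kL Lk.
Qed.

(** After a turn the walk passes another copy and reaches the single vertex it came from, closing
    after 4 steps. *)
Lemma ring_walk2 :
  (forall d p, p <= n -> ~~ mult p -> mult (mvn d p) -> ~~ mult (mvn d (mvn d p))) ->
  k = n.+1 \/ k = 4.
Proof.
move=> H; have [|/existsNP[t0 /eqP ft0]] := pselect (forall t, dr t.+1 = dr t).
  by left; apply: no_flip.
right; have [t ft] : exists t, dr t.+2 != dr t.+1.
  have fk u : f (u + k) = f u by apply/eqP; rewrite feqD.
  (* The turn is moved one period ahead, so that there are steps before it. *)
  exists (t0 + k).-1; rewrite prednK; last lia.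
  by move: ft0; rewrite /dr /ps -!addSn !fk.
have [s1 m1 d1 e1] := flip ft; have d0 := persist m1.
have m2 : mult (ps t.+3) by rewrite e1.
have d2 := persist m2.
have pt : ps t = mv (~~ dr t.+1) (mv (~~ dr t.+1) (ps t.+2)).
  by rewrite {1}psP -d0 -psP.
have e4 : ps t.+4 = ps t by rewrite psS d2 d1 e1 pt -psP.
have : f t.+4 == f t.
  apply/eqP/single_eq => //; rewrite e4 pt !val_mv; apply: H => //.
    by rewrite -ltnS ltn_ord.
  by rewrite -val_mv -psP.
rewrite -addn4 feqD => /[dup] /dvdn_leq h; move: (h isT) k3 => {h}.
by case: (k) => [|[|[|[|[|]]]]].
Qed.

(** A turn leads back along a parallel path of length 3 and closes after 6 steps. If [n = 2], both
    ends of the bundle are the same vertex, so the walk closes after 3 steps. *)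
Lemma ring_walk3 :
  (forall d p, p <= n -> ~~ mult p -> mult (mvn d p) ->
     mult (mvn d (mvn d p)) && ~~ mult (mvn d (mvn d (mvn d p)))) ->
  k = n.+1 \/ (k = 6 /\ 3 <= n).
Proof.
move=> H; have [|/existsNP[t0 /eqP ft0]] := pselect (forall t, dr t.+1 = dr t).
  by left; apply: no_flip.
have [t ft] : exists t, dr t.+3 != dr t.+2.
  have fk u : f (u + k) = f u by apply/eqP; rewrite feqD.
  exists (t0 + k).-2; rewrite (_ : (t0 + k).-2.+2 = t0 + k); last lia.
  by move: ft0; rewrite /dr /ps -!addSn !fk.
have [s1 m1 d1 e1] := flip ft; have d0 := persist m1.
have m2 : mult (ps t.+4) by rewrite e1.
have d2 := persist m2.
set e := ~~ dr t.+2; set s := ps t.+3 in s1 *.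
have p2 : ps t.+2 = mv e s by exact: psP.
have p1 : ps t.+1 = mv e (mv e s) by rewrite psP -d0 -/e p2.
have /andP[m0 s0] : mult (mv e (mv e s)) && ~~ mult (mv e (mv e (mv e s))).
  rewrite !val_mv; apply: H => //; first by rewrite -ltnS ltn_ord.
  by rewrite -val_mv -p2.
have d3 : dr t.+1 = dr t by apply: persist; rewrite p1.
have p0 : ps t = mv e (mv e (mv e s)) by rewrite psP -d3 -d0 -/e p1.
have p5 : ps t.+4.+1 = mv e (mv e s) by rewrite psS d2 d1 -/e e1 p2.
have d4 : dr t.+4.+1 = e by rewrite persist ?d2 ?d1 // p5.
have p6 : ps t.+4.+2 = mv e (mv e (mv e s)) by rewrite psS d4 p5.
have k6 : k %| 6.
  rewrite -(feqD t) !addnS addn0; apply/eqP/single_eq; rewrite p6 ?p0 //.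
have it3 : (mv e (mv e (mv e s)) == s) = (n.+1 %| 3).
  case: (e); first exact: (iter_ordS_id 3 s).
  set y := mv false (mv false (mv false s)).
  have sy : s = iter 3 (@ordS _) y.
    by rewrite -[RHS]/(mv (~~ false) (mv (~~ false) (mv (~~ false) y))) !mvK.
  by rewrite [X in _ == X]sy eq_sym iter_ordS_id.
have k3' : (k %| 3) = (n.+1 %| 3).
  rewrite -it3 -p6 -/(ps t.+3) -(feqD t.+3) !addnS addn0.
  apply/eqP/eqP => [h|h]; first by rewrite /ps h.
  by apply: single_eq => //; rewrite p6.
have [n3|n3] := leqP 3 n.
  have k6' := @dvdn_leq k 6 isT k6; right; split=> //; move: k6 k3' k6'.
  rewrite [n.+1 %| 3]gtnNdvd //.
  by move: k3; case: (k) => [|[|[|[|[|[|[|]]]]]]].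
have en : n = 2 by apply/eqP; rewrite eqn_leq -ltnS n3 n2.
left; rewrite en in k3' *; move: k3'; rewrite dvdnn => /(@dvdn_leq k 3 isT) h; apply/eqP; rewrite eqn_leq h k3 //.
Qed.

End Walk.

(** Positions form consecutive blocks, and odd blocks are reversed so that matched edges nest.
    Consecutive gaps alternate pages. The closing edges from position 0 to [n] could only cross
    edges of the last gap, which lies on the other page because [n] is even. *)
Lemma ring_book : ~~ odd n -> 2 <= n -> ~~ mult 0 -> rooted_book ring_root.
Proof.
move=> nodd n2 m0.
pose po (u : ring) : nat := (val u).1; pose ix (u : ring) : nat := (val u).2.
pose rho (u : ring) := po u * m.+1 + (if odd (po u) then m - ix u else ix u).
pose closing (u v : ring) := ((po u == 0) && (po v == n)) || ((po u == n) && (po v == 0)).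
pose page (u v : ring) := ~~ closing u v && odd (minn (po u) (po v)).
have ixlt (u : ring) : ix u < m.+1 by exact: ltn_ord.
have off (u : ring) : (if odd (po u) then m - ix u else ix u) < m.+1.
  by case: odd => //; rewrite ltnS leq_subr.
have pole (u : ring) : po u <= n by rewrite -ltnS; exact: ltn_ord.
have rho_le (u v : ring) : rho u < rho v -> po u <= po v.
  move=> h; rewrite leqNgt; apply/negP => lt.
  have := off v; have : po v * m.+1 + m.+1 <= po u * m.+1 by rewrite addnC -mulSn leq_mul2r lt orbT.
  by move: h; rewrite /rho; move: (po v * m.+1) (po u * m.+1) => a b; lia.
have rho_same (u v : ring) : po u = po v -> (rho u < rho v) = if odd (po v) then ix v < ix u else ix u < ix v.
  move=> e; rewrite /rho e ltn_add2l.
  move: (ixlt u) (ixlt v).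
  by case: odd => //; lia.
have same_eq (u v : ring) : po u = po v -> ix u = ix v -> u = v.
  by move=> e1 e2; apply: val_inj; rewrite [LHS]surjective_pairing [RHS]surjective_pairing;
    congr (_, _); apply: val_inj.
have single (u : ring) : ~~ mult (po u) -> ix u = 0.
  by move=> nm; have := valP u; rewrite /ring_ok -/(po u) (negPf nm) /= => /eqP; rewrite /ix => ->.
have adjP (u v : ring) : adj u v -> po u <= po v -> po v = (po u).+1 \/ (po u = 0 /\ po v = n).
  case/and3P=> ne /orP[] /eqP/(congr1 val) /= h _; rewrite -/(po u) -/(po v) in h.
    have := pole u; rewrite leq_eqVlt => /orP[/eqP e|lt].
      by move: h; rewrite e modnn => h; rewrite -h => ?; lia.
    by move: h; rewrite modn_small // => h; rewrite -h; left.
  have := pole v; rewrite leq_eqVlt => /orP[/eqP e|lt].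
    by move: h; rewrite e modnn => h; right; rewrite -h.
  by move: h; rewrite modn_small // => h; rewrite -h ltnn.
exists rho, page; split; last first.
  by move=> u; rewrite /rho /po /= mul0n.
split.
- move=> u v e; have pe : po u = po v.
    have := congr1 (fun x => x %/ m.+1) e; rewrite /rho /= !divnMDl //.
    by rewrite !divn_small ?off // !addn0.
  apply: same_eq => //; move: e; rewrite /rho pe => /addnI.
  move: (ixlt u) (ixlt v).
  by case: odd => //; lia.
- by move=> u v; rewrite /page /closing minnC orbC [(po u == 0) && _]andbC [(po u == n) && _]andbC.
move=> x y z w axy azw h1 h2 h3 pg.
have l1 := rho_le _ _ h1; have l2 := rho_le _ _ h2; have l3 := rho_le _ _ h3.
have zero (u v : ring) : po u = 0 -> po v = 0 -> rho u < rho v -> False.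
  move=> e1 e2; rewrite rho_same ?e1 ?e2 //= !single ?e1 ?e2 //.
case: (adjP _ _ axy) => [|e12|[e1 e2]]; first exact: leq_trans l1 l2.
  case: (adjP _ _ azw) => [|e34|[e3 e4]]; first exact: leq_trans l2 l3.
    have [e13|ne] := eqVneq (po x) (po z).
      have e24 : po y = po w by rewrite e12 e34 e13.
      move: (h1) (h3); rewrite !rho_same //.
      have idx (u v : ring) : adj u v -> mult (po u) -> mult (po v) -> ix u = ix v.
        by case/and3P=> _ _ /implyP h mu mv_; rewrite /ix (eqP (h _)) // -/(po u) -/(po v) mu mv_.
      have [mx|mx] := boolP (mult (po x)); last first.
        have sz : ix z = 0 by apply: single; rewrite -e13.
        by rewrite (single x mx) sz ltnn if_same.
      have [my|my] := boolP (mult (po y)); last first.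
        have sw : ix w = 0 by apply: single; rewrite -e24.
        by rewrite (single y my) sw ltnn if_same.
      have mz : mult (po z) by rewrite -e13.
      have mw : mult (po w) by rewrite -e24.
      rewrite e34 /= (idx _ _ axy mx my) (idx _ _ azw mz mw).
      by case: (odd (po z)) => /= i1 i2; have := ltn_trans i1 i2; rewrite ltnn.
    have e32 : po z = po y by lia.
    move: pg; rewrite /page /closing e34 e32 e12.
    have -> : minn (po x) (po x).+1 = po x by lia.
    have -> : minn (po x).+1 (po x).+2 = (po x).+1 by lia.
    have := pole y; have := pole w; rewrite e34 e32 e12.
    move: (po x) => p pn _; have -> : (p.+1 == n) = false by apply/eqP; lia.
    by rewrite !andbF /=; case: (odd p).
  by apply: (zero x z) => //; lia.
case: (adjP _ _ azw) => [|e34|[e3 e4]]; first exact: leq_trans l2 l3.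
  have e4 : po w = n by apply/eqP; rewrite eqn_leq pole -{1}e2.
  move: pg; rewrite /page /closing e1 e2 e4 !eqxx /=.
  have -> : minn (po z) n = n.-1 by lia.
  have -> : odd n.-1 = true by lia.
  by lia.
exact: (zero x z).
Qed.

End Ring.

(** * Minimal obstruction sets *)

(** For even [n], bundles of paths of length 2 from position 0 to [n], closed by a single edge. *)
Definition mult4 (p : nat) := odd p.
(* [mult6 c] describes bundles of paths of length 3 separated by single edges;
   the root, at position 0, is between two single edges if c = 0, and between two
   bundles if c = 1. *)
Definition mult6 (c p : nat) := (p + c) %% 4 \in [:: 2; 3].

Lemma ring4_forced_out D i : 0 < i -> forced_out D (ring_root (2 * i) (2 * D) mult4).
Proof.
move=> i0 I cI; apply/negP; rewrite -vx0 => I0.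
have Iv j : j <= i -> I (vx (2 * i) mult4 (2 * j) ord0).
  elim: j => [|j IH] ji; first by rewrite muln0.
  have m1 : mult4 (2 * j).+1 by rewrite /mult4; lia.
  have e2 : 2 * j.+1 = (2 * j).+2 by lia.
  apply: (bundle2 (u := vx (2 * i) mult4 (2 * j) ord0) cI
    (w := vx (2 * i) mult4 (2 * j).+1) (N := (2 * D).+1)); first by lia.
  - by apply: vx_inj => //; lia.
  - move=> a; apply: vx_adj; rewrite ?m1 ?eqxx ?orbT //; first by lia.
    by rewrite /mult4 => h; exfalso; lia.
  - move=> a; rewrite adj_sym e2; apply: vx_adj; rewrite ?m1 ?eqxx ?orbT //; first by lia.
    by rewrite /mult4 => _ h; exfalso; lia.
  - by apply: IH; apply: ltnW.
have [indep _] := cI; apply: (indep _ _ _ (Iv i (leqnn i)) I0).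
by apply: vx_close; rewrite ?eqxx ?orbT //; lia.
Qed.

Section Ring6.
Variables (n D c : nat) (I : pred (ring n (2 * D) (mult6 c))).
Hypothesis cI : coloring D I.
Let x p := vx n (mult6 c) p (ord0 : 'I_(2 * D).+1).

Lemma ring6_edge p : p < n -> ~~ (mult6 c p && mult6 c p.+1) -> I (x p) -> ~~ I (x p.+1).
Proof.
move=> pn ne Ip; apply/negP => Iq; have [indep _] := cI; apply: indep Ip Iq.
by apply: vx_adj; rewrite ?eqxx ?orbT // => h1 h2; rewrite h1 h2 in ne.
Qed.

Lemma ring6_bundle p : p.+2 < n -> (p + c) %% 4 = 1 -> ~~ I (x p) -> I (x p.+3).
Proof.
move=> pn pc Ip; apply/negPn/negP => Iq.
have mp : ~~ mult6 c p by rewrite /mult6 pc.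
have m1 : mult6 c p.+1 by rewrite /mult6 !inE; lia.
have m2 : mult6 c p.+2 by rewrite /mult6 !inE; lia.
have m3 : ~~ mult6 c p.+3 by rewrite /mult6 !inE; lia.
apply: (bundle3 cI (N := (2 * D).+1) (a := vx n (mult6 c) p.+1) (b := vx n (mult6 c) p.+2)
  _ _ _ _ _ _ Ip Iq) => //.
- by apply: vx_inj => //; lia.
- by apply: vx_inj => //; lia.
- move=> i; apply: vx_adj; rewrite ?m1 ?eqxx ?orbT //; first by lia.
  by move=> h; rewrite h in mp.
- by move=> i; apply: vx_adj; rewrite ?m1 ?m2 //; lia.
- move=> i; rewrite adj_sym; apply: vx_adj; rewrite ?m2 ?eqxx ?orbT //.
  by move=> _ h; rewrite h in m3.
Qed.

End Ring6.

(** With the root in [I], each edge leads out of [I] and each bundle back in, so position [4 * j],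
    adjacent to the root, would be in [I] too. *)
Lemma ring6_forced_out D j : 0 < j -> forced_out D (ring_root (4 * j) (2 * D) (mult6 0)).
Proof.
move=> j0 I cI; apply/negP; rewrite -vx0 => I0.
have Iv t : t <= j -> I (vx (4 * j) (mult6 0) (4 * t) ord0).
  elim: t => [|t IH] tj; first by rewrite muln0.
  have -> : 4 * t.+1 = (4 * t).+1.+3 by lia.
  apply: (ring6_bundle cI); [lia|lia|].
  apply: (ring6_edge cI); [lia| |by apply: IH; apply: ltnW].
  by rewrite /mult6 !inE; lia.
have [indep _] := cI; apply: (indep _ _ _ (Iv j (leqnn j)) I0).
by apply: vx_close; rewrite ?eqxx ?orbT //; lia.
Qed.

(** With the root outside [I], each bundle leads into [I] and each edge back out, so the last bundle
    would have both ends outside. *)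
Lemma ring6_forced_in D j : forced_in D (ring_root (4 * j + 2) (2 * D) (mult6 1)).
Proof.
move=> I cI; apply/negPn/negP; rewrite -vx0 => I0.
have Iv t : t <= j -> ~~ I (vx (4 * j + 2) (mult6 1) (4 * t) ord0).
  elim: t => [|t IH] tj; first by rewrite muln0.
  have -> : 4 * t.+1 = (4 * t).+3.+1 by lia.
  apply: (ring6_edge cI); [lia| by rewrite /mult6 !inE; lia|].
  by apply: (ring6_bundle cI); [lia|lia|]; apply: IH; apply: ltnW.
have m1 : mult6 1 (4 * j).+1 by rewrite /mult6 !inE; lia.
have m2 : mult6 1 (4 * j).+2 by rewrite /mult6 !inE; lia.
apply: (bundle3 cI (N := (2 * D).+1) (a := vx (4 * j + 2) (mult6 1) (4 * j).+1)
  (b := vx (4 * j + 2) (mult6 1) (4 * j).+2) _ _ _ _ _ _ (Iv j (leqnn j)) I0) => //.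
- by apply: vx_inj => //; lia.
- by apply: vx_inj => //; lia.
- move=> i; apply: vx_adj; rewrite ?m1 ?eqxx ?orbT //; first by lia.
  by rewrite /mult6 !inE => h; exfalso; lia.
- by move=> i; apply: vx_adj; rewrite ?m1 ?m2 //; lia.
- move=> i; rewrite adj_sym; have e : (4 * j).+2 = 4 * j + 2 by lia.
  by rewrite e; apply: vx_close; rewrite -?e ?m2 //; lia.
Qed.

Lemma gadget4 (R : realType) D i : 0 < i -> exists H : sgraph,
  [/\ planar R H, cycles_in H (fun k => k = 2 * i + 1 \/ k = 4) & ~ colorable [tuple 0; D] H].
Proof.
move=> i0; apply: (forced_obstruction R (r := ring_root (2 * i) (2 * D) mult4)).
- by apply: ring_book; rewrite /mult4; lia.
- move=> k f k3 fW; rewrite addn1; apply: (ring_walk2 _ _ k3 fW); rewrite /mult4 //; first by lia.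
  move=> d p pn; rewrite /mvn; case: d.
    by case: eqP => //= ne; case: eqP => //= ne' h1 h2; lia.
  by case: eqP => //= [e|ne]; [lia | case: eqP => //= ne' h1 h2; lia].
- by right; apply: ring4_forced_out.
Qed.

Lemma mult6_bundles n c : c <= 1 -> n = 2 * c %[mod 4] -> forall d p, p <= n ->
  ~~ mult6 c p -> mult6 c (mvn n d p) ->
  mult6 c (mvn n d (mvn n d p)) && ~~ mult6 c (mvn n d (mvn n d (mvn n d p))).
Proof.
move=> c1 nc d p pn; rewrite /mvn /mult6 !inE; case: d.
  case: (eqVneq p n) => [->|ne] /=; first by lia.
  case: (eqVneq p.+1 n) => [e|ne2] /=; first by lia.
  by case: (eqVneq p.+2 n) => [e|ne3] /=; lia.
case: (eqVneq p 0) => [->|ne] /=.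
  case: (eqVneq n 0) => [e|n0] /=; first by lia.
  by case: (eqVneq n.-1 0) => [e|n1] /=; lia.
case: (eqVneq p.-1 0) => [e|ne2] /=; first by lia.
by case: (eqVneq p.-2 0) => [e|ne3] /=; lia.
Qed.

Lemma gadget6 (R : realType) D i : 0 < i -> exists H : sgraph,
  [/\ planar R H, cycles_in H (fun k => k = 2 * i + 1 \/ (k = 6 /\ 1 < i)) &
   ~ colorable [tuple 0; D] H].
Proof.
(* Bundles and edges alternate with period 4, so the parity of [i] decides whether the cycle of
   length [2 * i + 1] closes with an edge or with a bundle. *)
move=> i0; pose c := odd i : nat; pose j := i./2; pose n := 4 * j + 2 * c.
have c1 : c <= 1 by rewrite /c; case: odd.
have ni : n = 2 * i by rewrite /n /c /j; lia.
apply: (forced_obstruction R (r := ring_root n (2 * D) (mult6 c))).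
- by apply: ring_book; rewrite /mult6 ?inE //; lia.
- move=> k f k3 fW.
  have n2 : 2 <= n by lia.
  have m0 : ~~ mult6 c 0 by rewrite /mult6 !inE; lia.
  have nc : n = 2 * c %[mod 4] by rewrite /n mulnC modnMDl.
  case: (ring_walk3 n2 m0 k3 fW (mult6_bundles c1 nc)) => [->|[-> n3]].
    by left; rewrite ni addn1.
  by right; split=> //; lia.
rewrite /n /c; case: (boolP (odd i)) => io.
  by left; apply: ring6_forced_in.
by right; rewrite muln0 addn0; apply: ring6_forced_out; rewrite /j; lia.
Qed.

Local Open Scope classical_set_scope.

Lemma obstruction_set_contains (R : realType) (X : set nat) (L : nat -> Prop) :
  cycle_obstruction_set R X ->
  (forall D, exists H : sgraph,
     [/\ planar R H, cycles_in H L & ~ colorable [tuple 0%N; D] H]) ->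
  exists k, X k /\ L k.
Proof.
case=> X3 [D XD] gad; have [H [pH cH nH]] := gad D.
apply: contrapT => no; apply: nH; apply: XD => // k Xk sub.
have k3 : (3 <= k)%N by exact: X3.
have [f fW] := subgraph_closed_walk k3 sub.
by apply: no; exists k; split=> //; apply: cH fW.
Qed.

Lemma odd_obstruction (R : realType) :
  cycle_obstruction_set R [set (2 * i + 1)%N | i in [set i : nat | (1 <= i)%N]].
Proof.
split=> [_ [i /= i1 <-] /=|]; first by lia.
exists 0%N => G _ nX; apply/colorableP/no_odd_cycle_coloring => i i1.
by apply: nX; exists i.
Qed.

Lemma three_four_six_obstruction (R : realType) :
  cycle_obstruction_set R [set k : nat | k = 3%N \/ k = 4%N \/ k = 6%N].
Proof.
split=> [k /= [->|[->|->]]//|]; exists 40%N => G pG nX; apply/colorableP.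
by apply: (planar_no346_colorable pG); apply: nX; rewrite /=; auto.
Qed.

Lemma obstruction_superset (R : realType) (X : set nat) : cycle_obstruction_set R X ->
  [set (2 * i + 1)%N | i in [set i : nat | (1 <= i)%N]] `<=` X \/
  [set k : nat | k = 3%N \/ k = 4%N \/ k = 6%N] `<=` X.
Proof.
move=> oX; apply: contrapT => /not_orP[/existsNP[l /not_implyP[[i /= i1 <-] nXi]]].
apply=> k /= k346; have [e3|ne3] := pselect (k = 3%N).
  (* The case [i = 1] has triangles as its only cycles, so 3 belongs to every obstruction set. The
     gadgets for the missing odd length then leave only 4, respectively 6, to be hit. *)
  have [l' [Xl']] := obstruction_set_contains oX (fun D => gadget6 R D (ltn0Sn 0)).
  by case=> [E|[]//]; rewrite e3 -[3%N]/(2 * 1 + 1)%N -E.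
case: k346 => [//|[->|->]].
  by have [l' [Xl' [E|<-//]]] := obstruction_set_contains oX (fun D => gadget4 R D i1);
    rewrite E in Xl'.
by have [l' [Xl' [E|[<-//]]]] := obstruction_set_contains oX (fun D => gadget6 R D i1);
    rewrite E in Xl'.
Qed.

Theorem theorem3p1 (R : realType) (X : set nat) :
  minimal_cycle_obstruction_set R X <->
  X = [set (2 * i + 1)%N | i in [set i : nat | (1 <= i)%N]] \/
  X = [set k : nat | k = 3%N \/ k = 4%N \/ k = 6%N].
Proof.
split=> [[oX minX]|[]->].
- case: (obstruction_superset oX) => sub; [left|right]; apply/esym/minX => //.
    exact: odd_obstruction.
  exact: three_four_six_obstruction.
- split; first exact: odd_obstruction.
  move=> Y sub oY; apply/seteqP; split=> //; case: (obstruction_superset oY) => // sub'.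
  have [|i _ e] := sub 4%N; first by apply: sub'; right; left.
  by exfalso; lia.
- split; first exact: three_four_six_obstruction.
  move=> Y sub oY; apply/seteqP; split=> //; case: (obstruction_superset oY) => // sub'.
  have Y5 : Y 5%N by apply: sub'; exists 2%N.
  by case: (sub _ Y5) => [//|[//|//]].
Qed.
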